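(* Let $d\ge2$ and let $\mathbf a=(a_1,\ldots,a_p)\in(\mathbb Z_+)^p$ be a vector of positive integers with $p\ge d$. Then $$h^{\Delta_{\min}(d,p,\mathbf a)}\le h^{\Delta}\quad\text{componentwise, for all }\Delta\in\mathcal M(d,p,\mathbf a).$$
   Context: A matroid on $[n]=\{1,\ldots,n\}$ is identified with its simplicial complex $\Delta$ of independent sets (a simplicial complex such that for $F,G\in\Delta$ with $|F|<|G|$ there is $i\in G\setminus F$ with $F\cup\{i\}\in\Delta$); every $v\in[n]$ is assumed to be a vertex of $\Delta$. The $1$-skeleton of a matroid, viewed as a graph on $[n]$ whose edges are the two-element faces, is a complete $p$-partite graph for some $p$. For a vector $\mathbf a=(a_1,\ldots,a_p)$ of positive integers with $a_1+\cdots+a_p=n$ and $p\ge d$, $\mathcal M(d,p,\mathbf a)$ is the class of all $(d-1)$-dimensional matroids on $[n]$ whose $1$-skeleton is complete $p$-partite with partition sets $A_1,\ldots,A_p$ of cardinalities $|A_i|=a_i$ (this depends only on $\mathbf a$ up to permutation of entries). For $t=0,\ldots,d-2$, $\Delta_t(d,p,\mathbf a)$ is the simplicial complex generated by all sets $\{v_1,\ldots,v_t,v_{i_1},\ldots,v_{i_{d-t}}\}$ with $t<i_1<\cdots<i_{d-t}\le p$ and $v_i\in A_i$, where $A_1,\ldots,A_p$ is a partition of $[n]$ with $|A_i|=a_i$; it is a matroid in $\mathcal M(d,p,\mathbf a)$. $\Delta_{\min}(d,p,\mathbf a)=\Delta_{d-2}(d,p,\mathbf a^\sigma)$, where $\mathbf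 a^\sigma=(a_{\sigma(1)},\ldots,a_{\sigma(p)})$ and $\sigma$ is a permutation with $a_{\sigma(1)}\le\cdots\le a_{\sigma(p)}$. $\Bbbk$ is a field, $S=\Bbbk[x_1,\ldots,x_n]$, $J(\Delta)=\bigcap_{F\text{ facet of }\Delta}(x_i : i\in F)$ is the cover ideal, and $h^\Delta$ is the $h$-vector of $S/J(\Delta)$, i.e. the coefficient vector of the polynomial $h(t)$ with Hilbert series of $S/J(\Delta)$ equal to $h(t)/(1-t)^{\dim S/J(\Delta)}$ (entries outside the range are $0$). *)

(* Defs.v *)
From HB Require Import structures.
From mathcomp Require Import all_boot all_order all_fingroup all_algebra.
From mathcomp.multinomials Require Import mpoly.
From Stdlib Require Import ClassicalEpsilon.

Set Implicit Arguments.
Unset Strict Implicit.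
Unset Printing Implicit Defensive.

Import GRing.Theory.
Local Open Scope ring_scope.

(* The ground set [n] is 'I_n, and indices are 0-based throughout. *)

Definition simplicial_complex (n : nat) (Delta : {set {set 'I_n}}) : Prop :=
  set0 \in Delta /\
  forall F G : {set 'I_n}, G \in Delta -> F \subset G -> F \in Delta.

Definition matroid (n : nat) (Delta : {set {set 'I_n}}) : Prop :=
  [/\ simplicial_complex Delta,
      forall v : 'I_n, [set v] \in Delta &
      forall F G : {set 'I_n}, F \in Delta -> G \in Delta -> (#|F| < #|G|)%N ->
        exists2 i, i \in G :\: F & i |: F \in Delta].

(* This is dim Delta + 1. *)
Definition complex_rank (n : nat) (Delta : {set {set 'I_n}}) : nat :=
  \max_(F in Delta) #|F|.

Definition facets (n : nat) (Delta : {set {set 'I_n}}) : {set {set 'I_n}} :=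
  [set F | maxset (fun G => G \in Delta) F].

Definition skeleton_edge (n : nat) (Delta : {set {set 'I_n}}) : rel 'I_n :=
  fun u v => (u != v) && ([set u; v] \in Delta).

(* A_1, ..., A_p is a partition of [n] with |A_i| = a_i. *)
Definition partition_of_shape (n p : nat) (a : 'I_p -> nat)
    (A : 'I_p -> {set 'I_n}) : Prop :=
  [/\ forall i, #|A i| = a i,
      forall i j, i != j -> [disjoint A i & A j] &
      \bigcup_i A i = [set: 'I_n]].

Definition complete_multipartite (n p : nat) (e : rel 'I_n)
    (A : 'I_p -> {set 'I_n}) : Prop :=
  forall u v, e u v = ~~ [exists i, (u \in A i) && (v \in A i)].

(* The class M(d, p, a). *)
Definition matroid_class (n d p : nat) (a : 'I_p -> nat)
    (Delta : {set {set 'I_n}}) : Prop :=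
  [/\ matroid Delta, complex_rank Delta = d &
      exists A : 'I_p -> {set 'I_n},
        partition_of_shape a A /\
        complete_multipartite (skeleton_edge Delta) A].

(* The sets {v_1, ..., v_t, v_{i_1}, ..., v_{i_(d-t)}}: one vertex v_i in each
   of the first t parts and in each part of a (d - t)-set I of later parts. *)
Definition Delta_gens (n p t d : nat) (A : 'I_p -> {set 'I_n}) :
    {set {set 'I_n}} :=
  [set F : {set 'I_n} |
    [exists v : {ffun 'I_p -> 'I_n}, exists I : {set 'I_p},
      [&& [forall i, v i \in A i], #|I| == (d - t)%N,
          [forall i in I, (t <= i)%N] &
          F == v @: ([set i : 'I_p | (i < t)%N] :|: I)]]].

(* The complex Delta_t(d, p, a) carried by the partition A. *)
Definition Delta_t (n p t d : nat) (A : 'I_p -> {set 'I_n}) :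
    {set {set 'I_n}} :=
  [set G : {set 'I_n} | [exists F in Delta_gens t d A, G \subset F]].

(* D is (a labelled copy of) Delta_min(d, p, a): any permutation sorting a and
   any partition of shape a^sigma are allowed. *)
Definition is_Delta_min (n d p : nat) (a : 'I_p -> nat)
    (D : {set {set 'I_n}}) : Prop :=
  exists (sigma : 'S_p) (A : 'I_p -> {set 'I_n}),
    [/\ forall i j : 'I_p, (i <= j)%N -> (a (sigma i) <= a (sigma j))%N,
        partition_of_shape (fun i => a (sigma i)) A &
        D = Delta_t (d - 2) d A].

Definition var_ideal (n : nat) (k : fieldType) (F : {set 'I_n})
    (f : {mpoly k[n]}) : Prop :=
  exists g : 'I_n -> {mpoly k[n]}, f = \sum_(i in F) g i * 'X_i.

Definition cover_ideal (n : nat) (k : fieldType) (Delta : {set {set 'I_n}})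
    (f : {mpoly k[n]}) : Prop :=
  forall F, F \in facets Delta -> var_ideal F f.

(* m = dim_k (S/I)_j for a homogeneous ideal I: f_1, ..., f_m are forms of
   degree j whose residue classes are a basis of (S/I)_j = S_j / (I \cap S_j). *)
Definition is_graded_dim (n : nat) (k : fieldType) (I : {mpoly k[n]} -> Prop)
    (j m : nat) : Prop :=
  exists f : 'I_m -> {mpoly k[n]},
    [/\ forall i, f i \is j.-homog,
        forall c : 'I_m -> k, I (\sum_i c i *: f i) -> forall i, c i = 0 &
        forall g : {mpoly k[n]}, g \is j.-homog ->
          exists c : 'I_m -> k, I (g - \sum_i c i *: f i)].

(* The Hilbert function of S/I. *)
Definition hilbert_fun (n : nat) (k : fieldType) (I : {mpoly k[n]} -> Prop)
    (j : nat) : nat :=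
  epsilon (inhabits 0%N) (is_graded_dim I j).

(* A chain P_0 < ... < P_l of prime ideals of S containing I, i.e. of primes
   of S/I; properness is part of idealr_closed.  Boolean predicates lose no
   generality, by excluded_middle_informative. *)
Definition prime_chain (n : nat) (k : fieldType) (I : {mpoly k[n]} -> Prop)
    (l : nat) : Prop :=
  exists P : 'I_l.+1 -> {pred {mpoly k[n]}},
    [/\ forall i, idealr_closed (P i),
        forall i, prime_idealr_closed (P i),
        forall i f, I f -> f \in P i &
        forall i j : 'I_l.+1, (i < j)%N ->
          {subset P i <= P j} /\ ~ {subset P j <= P i}].

Definition is_krull_dim (n : nat) (k : fieldType) (I : {mpoly k[n]} -> Prop)
    (D : nat) : Prop :=
  prime_chain I D /\ forall l, prime_chain I l -> (l <= D)%N.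

(* The Krull dimension of S/I. *)
Definition krull_dim (n : nat) (k : fieldType) (I : {mpoly k[n]} -> Prop) :
    nat :=
  epsilon (inhabits 0%N) (is_krull_dim I).

(* Coefficient of t^j in h(t) = (1 - t)^(dim S/I) * Hilb(S/I, t). *)
Definition h_coef (n : nat) (k : fieldType) (I : {mpoly k[n]} -> Prop)
    (j : nat) : int :=
  \sum_(i < j.+1)
    ((1 - 'X : {poly int}) ^+ krull_dim I)`_i * (hilbert_fun I (j - i))%:Z.

Definition h_vector (n : nat) (k : fieldType) (Delta : {set {set 'I_n}}) :
    nat -> int :=
  h_coef (@cover_ideal n k Delta).

(* Main.v *)
Require Import Defs.
From mathcomp Require Import all_boot all_order all_fingroup all_algebra.
From mathcomp.multinomials Require Import mpoly.
From mathcomp Require Import zify ring.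
From Stdlib Require Import ClassicalEpsilon Classical_Prop.

(* A monomial lies outside J(Delta) iff its zero set contains a facet.  Hence,
   if Delta has rank d, (1 - t)^d h^Delta(t) is the sum over the vertex sets Z
   containing a facet of (1 - t)^|Z| t^(n - |Z|); grouping the Z by the parts
   they meet turns this into a sum over the spanning sets W of the simplified
   matroid on the parts, of prod_(i in W) (1 - t^a_i) prod_(i notin W) t^a_i.
   For a part e that is neither a loop nor a coloop, deletion and contraction
   give h(M) = [a_e] h(M/e) + t^a_e h(M \ e) with [m] = 1 + ... + t^(m-1), and
   h(M) = [a_e] h(M/e) if e is a coloop.

   Removing the largest part first, one proves more generally that if every set
   of at most c parts is independent, then h(M) is at least the h-polynomial of
   the matroid that is uniform of rank c on the large parts and free on the
   r - c smallest ones: M/e satisfies the hypothesis for c - 1, M \ e for c, and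
   a large coloop can be exchanged for the largest of the free parts.  The
   theorem is the case c = 2, which is an equality for Delta_min. *)

Set Implicit Arguments.
Unset Strict Implicit.
Unset Printing Implicit Defensive.

Import GRing.Theory Num.Theory.
Local Open Scope ring_scope.

(** * Weighted spanning sums and deletion-contraction *)

Definition geom (m : nat) : {poly int} := \sum_(i < m) 'X^i.

Lemma subr_exprX_geom m : 1 - 'X^m = (1 - 'X) * geom m.
Proof. by rewrite -opprB subrX1 -mulNr opprB. Qed.

Notation nneg p := ((p : {poly int}) \is a polyOver (@Num.Def.nneg_num_pred int)).

Lemma nneg_coef (p q : {poly int}) i : nneg (q - p) -> p`_i <= q`_i.
Proof.
by move/polyOverP/(_ i); rewrite coefB unfold_in subr_ge0.
Qed.

Lemma nneg_X m : nneg ('X^m).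
Proof. by apply/polyOverP => i; rewrite coefXn nnegrE ler0n. Qed.

Lemma nneg_geom m : nneg (geom m).
Proof. by apply: rpred_sum => i _; apply: nneg_X. Qed.

Lemma geom_add m m' : geom (m + m') = geom m + 'X^m * geom m'.
Proof.
rewrite /geom big_split_ord /= mulr_sumr; congr (_ + _).
by apply: eq_bigr => i _; rewrite exprD.
Qed.

Lemma geom_leq m m' : (m <= m')%N -> nneg (geom m' - geom m).
Proof.
move=> h; rewrite -(subnKC h) geom_add [X in X - _]addrC addrK.
by rewrite rpredM ?nneg_X ?nneg_geom.
Qed.

Lemma one_minus_X_neq0 : (1 - 'X : {poly int}) != 0.
Proof. by rewrite -opprB oppr_eq0 -[1]/(1%:P) polyXsubC_eq0. Qed.

(* [1 - X] times the difference is [X^x - X^y] *)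
Lemma geom_shift_nneg x y : (x <= y)%N ->
  nneg ('X^x * geom y - 'X^y * geom x).
Proof.
move=> h; suff -> : 'X^x * geom y - 'X^y * geom x = geom y - geom x by exact: geom_leq.
apply: (mulfI one_minus_X_neq0).
rewrite !mulrBr ![(1 - 'X) * (_ * _)]mulrCA -!subr_exprX_geom.
ring.
Qed.

Section Bases.

Variables (T : finType) (b : T -> nat).
Implicit Types (s : seq T) (S : pred {set T}) (Bs : {set {set T}}) (W : {set T}).

(** For duplicate-free [s] this is the sum, over the [W] contained in [s] with [S W], of the product
    of [1 - 'X^(b e)] for [e] in [W] and of ['X^(b e)] for the other [e] in [s]. Recursion on the
    head makes deletion and contraction of that element immediate. *)
Fixpoint weighted_sum s S : {poly int} :=
  if s is e :: s' then
    (1 - 'X^(b e)) * weighted_sum s' (fun W => S (e |: W))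
      + 'X^(b e) * weighted_sum s' S
  else (S set0)%:R.

Lemma eq_weighted_sum s S1 S2 :
  (forall W, W \subset s -> S1 W = S2 W) ->
  weighted_sum s S1 = weighted_sum s S2.
Proof.
elim: s S1 S2 => [|e s IH] S1 S2 eqS /=.
  by rewrite eqS //; apply/subsetP => x; rewrite inE.
congr (_ * _ + _ * _); apply: IH => W sW; apply: eqS.
  apply/subsetP => x; rewrite !inE => /orP[/eqP->|xW]; first by rewrite eqxx.
  by rewrite (subsetP sW) ?orbT.
by apply/subsetP => x xW; rewrite inE (subsetP sW) ?orbT.
Qed.

Lemma weighted_sum0 s : weighted_sum s pred0 = 0.
Proof. by elim: s => //= e s IH; rewrite IH !mulr0 addr0. Qed.

(* [(1 - 'X) ^- c] times the weighted sum of the uniform matroid of rank [c]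
   on [s], by deletion and contraction of the head. *)
Fixpoint uniform_h (c : nat) s : {poly int} :=
  match c, s with
  | 0%N, _ => 1
  | _.+1, [::] => 0
  | c'.+1, e :: s' => geom (b e) * uniform_h c' s' + 'X^(b e) * uniform_h c s'
  end.

Lemma uniform_h0 s : uniform_h 0 s = 1. Proof. by case: s. Qed.

Lemma nneg_uniform c s : nneg (uniform_h c s).
Proof.
elim: s c => [|e s IH] [|c] //=; rewrite ?rpred1 ?rpred0 //.
by rewrite rpredD // rpredM // ?nneg_geom ?nneg_X.
Qed.

Lemma uniform_h_small c s : (size s < c)%N -> uniform_h c s = 0.
Proof.
elim: s c => [|e s IH] [|c] //= h; rewrite !IH ?mulr0 ?addr0 //.
by apply: ltnW.
Qed.

Lemma uniform_h_rcons c s x :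
  uniform_h c.+1 (rcons s x) = geom (b x) * uniform_h c s + 'X^(b x) * uniform_h c.+1 s.
Proof.
elim: s c => [//|e s IH] c /=.
rewrite IH; case: c => [|c]; last by rewrite IH; ring.
(* For [c = 0] both sides begin with the geometric sum of length [b e + b x], split in the two
   possible orders. *)
rewrite !uniform_h0 !mulr1 !mulrDr !addrA -!geom_add addnC.
by rewrite mulrCA.
Qed.

(** Expanding at [x] and at [e], the terms in [uniform_h c s] cancel and a multiple of
    [uniform_h c.+1 s] remains. This pays for exchanging a large coloop [e] with a free part [x]. *)
Lemma uniform_h_exchange c s e x : (b x <= b e)%N ->
  nneg (geom (b e) * uniform_h c.+1 (rcons s x) - uniform_h c.+1 (e :: s) * geom (b x)).
Proof.
move=> h; rewrite uniform_h_rcons /=.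
set u := uniform_h c s; set v := uniform_h c.+1 s.
rewrite (_ : _ - _ = ('X^(b x) * geom (b e) - 'X^(b e) * geom (b x)) * v); last by ring.
by rewrite rpredM ?geom_shift_nneg ?nneg_uniform.
Qed.

(** * Matroids given by their bases *)

Definition spans Bs : pred {set T} := fun W => [exists B in Bs, B \subset W].

Definition basis_exchange Bs : Prop :=
  forall B1 B2 x, B1 \in Bs -> B2 \in Bs -> x \in B1 :\: B2 ->
    exists2 y, y \in B2 :\: B1 & y |: (B1 :\ x) \in Bs.

Definition basis_system r s Bs : Prop :=
  [/\ Bs != set0, forall B, B \in Bs -> #|B| = r,
      forall B, B \in Bs -> B \subset s & basis_exchange Bs].

(** For [c = 2] the matroid is simple; general [c] is needed for the induction, since contraction
    may lower it by one. *)
Definition uniformly_free c s Bs : Prop :=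
  forall X : {set T}, X \subset s -> (#|X| <= c)%N ->
    exists2 B, B \in Bs & X \subset B.

(** If [e] is a coloop the first family is empty, and if [e] is a loop the second one is; only in
    the other cases are these the bases of the deletion and the contraction. *)
Definition deletion e Bs := [set B in Bs | e \notin B].
Definition contraction e Bs := [set B :\ e | B in Bs & e \in B].

Lemma mem_contraction e Bs B :
  (B \in contraction e Bs) = (e \notin B) && (e |: B \in Bs).
Proof.
apply/imsetP/andP => [[B' /[!inE]/andP[B'Bs eB'] ->]|[eB eBBs]].
  by rewrite setD11 setD1K.
by exists (e |: B); rewrite ?setU1K // !inE eBBs eqxx.
Qed.

Lemma subset_consP e s W : e \notin W -> W \subset e :: s -> W \subset s.
Proof.
move=> eW /subsetP h; apply/subsetP => x xW; move: (h x xW); rewrite inE.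
by case/orP=> // /eqP xe; rewrite -xe xW in eW.
Qed.

Lemma deletion_system r e s Bs B0 : B0 \in Bs -> e \notin B0 ->
  basis_system r (e :: s) Bs -> basis_system r s (deletion e Bs).
Proof.
move=> B0Bs eB0 [_ card sub exch]; split.
- by apply/set0Pn; exists B0; rewrite inE B0Bs.
- by move=> B /[!inE]/andP[/card].
- by move=> B /[!inE]/andP[/sub sB eB]; apply: subset_consP sB.
move=> B1 B2 x /[!inE]/andP[B1Bs eB1] /andP[B2Bs eB2] xB.
have [|y yB yBs] := exch B1 B2 x B1Bs B2Bs; first by move: xB; rewrite !inE.
exists y; first by move: yB; rewrite !inE.
move: yBs; rewrite !inE => ->; rewrite (negbTE eB1) andbF orbF eq_sym.
by apply: contraNneq eB2 => <-; move: yB; rewrite inE => /andP[].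
Qed.

Lemma contraction_system r e s Bs B0 : B0 \in Bs -> e \in B0 ->
  basis_system r.+1 (e :: s) Bs -> basis_system r s (contraction e Bs).
Proof.
move=> B0Bs eB0 [_ card sub exch]; split.
- apply/set0Pn; exists (B0 :\ e).
  by rewrite mem_contraction setD11 setD1K.
- move=> B; rewrite mem_contraction => /andP[eB /card].
  by rewrite cardsU1 eB => -[].
- move=> B; rewrite mem_contraction => /andP[eB /sub sB].
  by apply: (subset_consP eB); apply: subset_trans sB; apply: subsetUr.
move=> B1 B2 x; rewrite !mem_contraction.
move=> /andP[eB1 B1Bs] /andP[eB2 B2Bs] /[!inE]/andP[xB2 xB1].
have xe : x != e by apply: contraNneq eB1 => <-.
have [|y] := exch _ _ x B1Bs B2Bs; first by rewrite !inE negb_or xe xB2 xB1 orbT.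
rewrite !inE negb_or => /andP[/andP[ye yB1] /orP[/eqP/eqP|yB2]].
  by rewrite (negbTE ye).
move=> yBs; exists y; first by rewrite !inE yB1.
rewrite mem_contraction !inE negb_or eq_sym ye (negbTE eB1) andbF /=.
suff -> : e |: (y |: B1 :\ x) = y |: (e |: B1) :\ x by [].
apply/setP => z; rewrite !inE; case: (eqVneq z e) => [->|_] //=.
by rewrite [e == x]eq_sym xe orbT.
Qed.

Lemma spans_deletion e Bs W : e \notin W -> spans Bs W = spans (deletion e Bs) W.
Proof.
move=> eW; apply/existsP/existsP => -[B /andP[BBs BW]]; exists B.
  rewrite inE BBs BW !andbT /=; apply: contra eW; exact: (subsetP BW).
by move: BBs; rewrite inE BW => /andP[->].
Qed.

(* Among the bases through [e], one with [B :\: B'] minimal differs from [B']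
   only in [e]. *)
Lemma basis_through Bs B0 B' e : basis_exchange Bs -> B0 \in Bs -> e \in B0 ->
  B' \in Bs -> exists2 B, B \in Bs & (e \in B) && (B \subset e |: B').
Proof.
move=> exch B0Bs eB0 B'Bs.
pose P (B : {set T}) := (B \in Bs) && (e \in B).
have P0 : P B0 by rewrite /P B0Bs.
case: (arg_minnP (fun B : {set T} => #|B :\: B'|) P0) => B /andP[BBs eB] minB.
exists B => //; rewrite eB /=; apply/subsetP => x xB; rewrite !inE.
case: (eqVneq x e) => //= xe; apply/negPn/negP => xB'.
have [|y] := exch B B' x BBs B'Bs; first by rewrite inE xB'.
rewrite inE => /andP[yB yB'] yBs.
have := minB (y |: B :\ x); rewrite /P yBs !inE eB [e == x]eq_sym xe orbT => /(_ isT).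
rewrite leqNgt => /negP; apply; apply: proper_card; apply/properP; split.
  apply/subsetP => z; rewrite !inE => /andP[zB' /orP[/eqP zy|/andP[_ ->]]].
    by rewrite zy yB' in zB'.
  by rewrite zB'.
exists x; rewrite !inE ?xB' // eqxx andFb orbF negb_and; apply/orP; right.
by apply: contraNneq xB' => ->.
Qed.

(** A basis inside [e |: W] may avoid [e]; [basis_through] replaces it by one through [e] without
    leaving [e |: W]. *)
Lemma spans_contraction e Bs B0 W : basis_exchange Bs -> B0 \in Bs -> e \in B0 ->
  e \notin W -> spans Bs (e |: W) = spans (contraction e Bs) W.
Proof.
move=> exch B0Bs eB0 eW; apply/existsP/existsP => -[B /andP[BBs BW]].
  have [B1 B1Bs /andP[eB1 sB1]] := basis_through exch B0Bs eB0 BBs.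
  exists (B1 :\ e); rewrite mem_contraction setD11 setD1K // B1Bs /=.
  apply/subsetP => x; rewrite !inE => /andP[xe xB1].
  move: (subsetP sB1 x xB1); rewrite !inE (negbTE xe) /= => /(subsetP BW).
  by rewrite !inE (negbTE xe).
move: BBs; rewrite mem_contraction => /andP[_ eBBs].
by exists (e |: B); rewrite eBBs setUS.
Qed.

Lemma spans_loop e Bs W : (forall B, B \in Bs -> e \notin B) ->
  spans Bs (e |: W) = spans Bs W.
Proof.
move=> loop; apply/existsP/existsP => -[B /andP[BBs BW]]; exists B; rewrite BBs /=.
  apply/subsetP => x xB; move: (subsetP BW x xB); rewrite !inE => /orP[/eqP xe|//].
  by move: (loop B BBs); rewrite -xe xB.
exact: subset_trans BW (subsetUr _ _).
Qed.

Lemma free_contraction c e s Bs : e \notin s ->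
  uniformly_free c.+1 (e :: s) Bs -> uniformly_free c s (contraction e Bs).
Proof.
move=> es free X sX cX.
have eX : e \notin X by apply: contra es; exact: (subsetP sX).
have [||B BBs sB] := free (e |: X).
- apply/subsetP => x; rewrite !inE => /orP[->//|/(subsetP sX)->].
  by rewrite orbT.
- by rewrite cardsU1 eX.
exists (B :\ e); last by rewrite subsetD1 eX (subset_trans (subsetUr _ _) sB).
by rewrite mem_contraction setD11 setD1K // (subsetP sB) // setU11.
Qed.

Lemma subset_cons e s W : W \subset s -> W \subset e :: s.
Proof. by move=> /subsetP h; apply/subsetP => x /h; rewrite inE => ->; rewrite orbT. Qed.

(** Contracting a coloop does not lower [c], because any basis containing [X] contains [e] as
    well. *)
Lemma free_coloop c e s Bs : e \notin s -> (forall B, B \in Bs -> e \in B) ->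
  uniformly_free c (e :: s) Bs -> uniformly_free c s (contraction e Bs).
Proof.
move=> es coloop free X sX cX.
have eX : e \notin X by apply: contra es; exact: (subsetP sX).
have [B BBs sB] := free X (subset_cons _ sX) cX.
exists (B :\ e); last by rewrite subsetD1 sB eX.
by rewrite mem_contraction setD11 setD1K // coloop.
Qed.

(** If the basis containing [X] passes through [e], then [e] is exchanged for an element of [B0],
    which leaves [X] inside. *)
Lemma free_deletion c e s Bs B0 : e \notin s -> basis_exchange Bs ->
  B0 \in Bs -> e \notin B0 ->
  uniformly_free c (e :: s) Bs -> uniformly_free c s (deletion e Bs).
Proof.
move=> es exch B0Bs eB0 free X sX cX.
have eX : e \notin X by apply: contra es; exact: (subsetP sX).
have [B BBs sB] := free X (subset_cons _ sX) cX.
have [eB|eB] := boolP (e \in B); last by exists B; rewrite // inE BBs.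
have [|y] := exch B B0 e BBs B0Bs; first by rewrite inE eB0.
rewrite inE => /andP[yB yB0] yBs; exists (y |: B :\ e).
  rewrite inE yBs !inE eqxx orbF; by apply: contraNneq eB0 => ->.
by apply: subset_trans (subsetUr _ _); rewrite subsetD1 sB.
Qed.

Lemma weighted_sum_contraction e s Bs B0 : e \notin s -> basis_exchange Bs ->
  B0 \in Bs -> e \in B0 ->
  weighted_sum (e :: s) (spans Bs) =
    (1 - 'X^(b e)) * weighted_sum s (spans (contraction e Bs))
      + 'X^(b e) * weighted_sum s (spans (deletion e Bs)).
Proof.
move=> es exch B0Bs eB0 /=; congr (_ * _ + _ * _); apply: eq_weighted_sum => W sW.
  apply: (spans_contraction (B0 := B0)) => //; apply: contra es; exact: (subsetP sW).
apply: spans_deletion; apply: contra es; exact: (subsetP sW).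
Qed.

Lemma weighted_sum_coloop e s Bs B0 : e \notin s -> basis_exchange Bs ->
  B0 \in Bs -> (forall B, B \in Bs -> e \in B) ->
  weighted_sum (e :: s) (spans Bs) =
    (1 - 'X^(b e)) * weighted_sum s (spans (contraction e Bs)).
Proof.
move=> es exch B0Bs coloop.
rewrite (weighted_sum_contraction es exch B0Bs (coloop _ B0Bs)).
rewrite (@eq_weighted_sum _ (spans (deletion e Bs)) pred0) ?weighted_sum0.
  by rewrite mulr0 addr0.
move=> W _; apply/existsP => -[B]; rewrite inE => /andP[/andP[/coloop->]].
by [].
Qed.

Lemma weighted_sum_loop e s Bs : (forall B, B \in Bs -> e \notin B) ->
  weighted_sum (e :: s) (spans Bs) = weighted_sum s (spans Bs).
Proof.
move=> loop /=; rewrite (eq_weighted_sum (S2 := spans Bs)); first by ring.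
by move=> W _; apply: spans_loop.
Qed.

(** Induction on the number of parts, which are removed in nonincreasing order of size. The
    comparison matroid is uniform of rank [c] on [s1] and free on [s2]. *)
Lemma weighted_sum_bound c r s1 s2 Bs :
  uniq (s1 ++ s2) -> pairwise (fun x y => b y <= b x)%N (s1 ++ s2) ->
  r = (c + size s2)%N -> basis_system r (s1 ++ s2) Bs ->
  uniformly_free c (s1 ++ s2) Bs ->
  exists2 h, weighted_sum (s1 ++ s2) (spans Bs) = (1 - 'X) ^+ r * h &
    nneg (h - uniform_h c s1 * \prod_(e <- s2) geom (b e)).
Proof.
move: {2}(size (s1 ++ s2)) (leqnn (size (s1 ++ s2))) => N.
elim: N => [|N IH] in c r s1 s2 Bs *.
  rewrite leqn0 size_eq0 => /eqP; case: s1 => //; case: s2 => //= _ _ _.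
  rewrite addn0 => -> [/set0Pn[B BBs] card sub exch] _.
  have B0 : B = set0.
    by apply/setP => x; rewrite in_set0; apply/negP => /(subsetP (sub B BBs)).
  have := card B BBs; rewrite B0 cards0 => <-.
  exists 1; last by rewrite big_nil mulr1 subrr rpred0.
  rewrite expr0 mulr1 (_ : spans Bs set0 = true) //.
  by apply/existsP; exists B; rewrite BBs B0 /=.
case: s1 => [|e s1].
  case: s2 => [_|e s2]; first exact: (IH c r [::] [::] Bs).
  (* The rank is at least the number of parts, so the ground set is the only basis, [c = 0] and
     every part is a coloop. *)
  rewrite cat0s => sN us ss rE sys free.
  have [/set0Pn[B0 B0Bs] card sub exch] := sys.
  have full B : B \in Bs -> [set x in e :: s2] = B.
    move=> BBs; apply/esym/eqP; rewrite eqEcard; apply/andP; split.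
      by apply/subsetP => x /(subsetP (sub B BBs)); rewrite inE.
    by rewrite (card B BBs) rE cardsE (card_uniqP us) leq_addl.
  have c0 : c = 0%N.
    move: (card B0 B0Bs); rewrite -(full _ B0Bs) cardsE (card_uniqP us) rE.
    by lia.
  subst c; move: us ss; rewrite cons_uniq pairwise_cons => /andP[es us] /andP[_ ss].
  have coloop B : B \in Bs -> e \in B by move/full <-; rewrite !inE eqxx.
  rewrite rE add0n in sys *.
  have [||||||h hE hn] := IH 0%N (size s2) [::] s2 (contraction e Bs) => //.
    exact: (contraction_system B0Bs (coloop _ B0Bs)).
    exact: free_coloop.
  exists (geom (b e) * h).
    rewrite (weighted_sum_coloop es exch B0Bs coloop) hE subr_exprX_geom exprS.
    by ring.
  rewrite uniform_h0 mul1r big_cons -mulrBr rpredM ?nneg_geom //.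
  by move: hn; rewrite uniform_h0 mul1r.
rewrite !cat_cons; set s := s1 ++ s2; rewrite ltnS.
rewrite cons_uniq pairwise_cons => sN /andP[es us] /andP[/allP maxe ss] rE sys free.
have [/set0Pn[B1 B1Bs] card sub exch] := sys.
case: (boolP [exists B in Bs, e \in B]) => [/existsP[B0 /andP[B0Bs eB0]]|noB]; last first.
  have loop B : B \in Bs -> e \notin B.
    by move=> BBs; apply: contra noB => eB; apply/existsP; exists B; rewrite BBs.
  have c0 : c = 0%N.
    case: c rE free => // c _ free.
    have [||B BBs] := free [set e].
    - by apply/subsetP => x; rewrite !inE => ->.
    - by rewrite cards1.
    by rewrite sub1set (negbTE (loop B BBs)).
  subst c; have [||||||h hE hn] := IH 0%N r s1 s2 Bs => //.
  - split=> // [|B BBs]; first by apply/set0Pn; exists B1.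
    exact: subset_consP (loop B BBs) (sub B BBs).
  - move=> X sX cX; exact: free (subset_cons _ sX) cX.
  exists h; first by rewrite -hE (weighted_sum_loop _ loop).
  by rewrite uniform_h0 in hn *.
have [r' rE'] : exists r', r = r'.+1.
  exists r.-1; rewrite prednK // -(card B0 B0Bs) card_gt0.
  by apply/set0Pn; exists e.
have csys : basis_system r' s (contraction e Bs).
  by apply: contraction_system B0Bs eB0 _; rewrite -rE'.
have sumE := weighted_sum_contraction es exch B0Bs eB0.
have dich : (exists2 B2, B2 \in Bs & e \notin B2) \/ (forall B, B \in Bs -> e \in B).
  case: (boolP [exists B in Bs, e \notin B]) => [/existsP[B /andP[]]|no].
    by left; exists B.
  right=> B BBs; apply: contraNT no => eB; apply/existsP; exists B.
  by rewrite BBs.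
have pos2 t : nneg (\prod_(x <- t) geom (b x)).
  by rewrite rpred_prod // => i _; exact: nneg_geom.
(* The contribution [h''] of the deletion is zero if [e] is a coloop, since then no basis avoids
   [e]; otherwise the induction hypothesis bounds it from below. *)
have [h'' [del h''0 h''n]] : exists h'',
    [/\ weighted_sum s (spans (deletion e Bs)) = (1 - 'X) ^+ r * h'', nneg h'' &
      (exists2 B2, B2 \in Bs & e \notin B2) ->
      nneg (h'' - uniform_h c s1 * \prod_(e <- s2) geom (b e))].
  have [[B2 B2Bs eB2]|coloop] := dich.
    have [||||||h hE hn] := IH c r s1 s2 (deletion e Bs) => //.
      exact: deletion_system B2Bs eB2 _.
      exact: free_deletion exch B2Bs eB2 _.
    exists h; split=> //; rewrite -(subrK (uniform_h c s1 * \prod_(e <- s2) geom (b e)) h).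
    by rewrite rpredD // rpredM ?nneg_uniform.
  exists 0; rewrite rpred0 mulr0; split=> // [|[B /coloop->//]].
  rewrite -(weighted_sum0 s); apply: eq_weighted_sum => W _; apply/existsP => -[B].
  by rewrite inE => /andP[/andP[/coloop->]].
have final h' : weighted_sum s (spans (contraction e Bs)) = (1 - 'X) ^+ r' * h' ->
    nneg (geom (b e) * h' + 'X^(b e) * h''
      - uniform_h c (e :: s1) * \prod_(e <- s2) geom (b e)) ->
    exists2 h, weighted_sum (e :: s) (spans Bs) = (1 - 'X) ^+ r * h &
    nneg (h - uniform_h c (e :: s1) * \prod_(e <- s2) geom (b e)).
  move=> hE hn; exists (geom (b e) * h' + 'X^(b e) * h'') => //.
  rewrite sumE hE del rE' subr_exprX_geom exprS; ring.
case: c => [|c] in rE free h''n final *.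
  (* For [c = 0] the part [e] takes the place of the head [x] of [s2], which joins [s1]: since
     [b x <= b e], the factor [geom (b e)] dominates [geom (b x)]. *)
  case: s2 => [|x s2] in @s rE sN us es maxe ss sys sub free csys sumE del h''n final *.
    by rewrite rE in rE'.
  have [||||||h' hE hn] := IH 0%N r' (rcons s1 x) s2 (contraction e Bs);
    rewrite ?cat_rcons //.
  - by apply/eqP; rewrite -eqSS -rE' rE.
  - move=> X _; rewrite leqn0 cards_eq0 => /eqP->.
    by case: csys => /set0Pn[B BBs] _ _ _; exists B; rewrite ?sub0set.
  - rewrite cat_rcons in hE; apply: final hE _.
    rewrite !uniform_h0 mul1r in hn *; rewrite big_cons.
    set P := \prod_(e <- s2) _ in hn *.
    rewrite (_ : _ - _ = geom (b e) * (h' - P) + (geom (b e) - geom (b x)) * P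
      + 'X^(b e) * h''); last by ring.
    rewrite !rpredD // rpredM ?nneg_geom ?nneg_X ?pos2 //.
    by apply/geom_leq/maxe; rewrite mem_cat inE eqxx orbT.
have r'E : r' = (c + size s2)%N by apply/eqP; rewrite -eqSS -rE' rE.
have [nocoloop|coloop] := dich.
  (* If [e] is neither a loop nor a coloop, the bounds for the contraction, with [c], and for the
     deletion, with [c.+1], combine along the recursion of [uniform_h]. *)
  have [||||||h' hE hn] := IH c r' s1 s2 (contraction e Bs) => //.
    exact: free_contraction.
  apply: final hE _ => /=; set P := \prod_(e <- s2) _ in hn h''n *.
  rewrite (_ : _ - _ = geom (b e) * (h' - uniform_h c s1 * P)
    + 'X^(b e) * (h'' - uniform_h c.+1 s1 * P)); last by ring.
  by rewrite rpredD // rpredM ?nneg_geom ?nneg_X // h''n.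
case: s2 => [|x s2] in @s rE r'E sN us es maxe ss sys sub free csys sumE del h''n final *.
  (* Here the rank is [c.+1]. If [s1] had [c.+1] elements, they would lie in a basis that also
     contains the coloop [e], which is too large; hence [uniform_h c.+1 s1] vanishes. *)
  have small : (size s1 < c.+1)%N.
    rewrite ltnNge; apply/negP => big.
    have [||B BBs sB] := free [set x in take c.+1 s1].
    - apply/subsetP => x; rewrite inE => /mem_take xs.
      by rewrite inE mem_cat xs orbT.
    - by rewrite cardsE (leq_trans (card_size _)) // size_take_min geq_minl.
    have /subset_leq_card : e |: [set x in take c.+1 s1] \subset B.
      by rewrite subUset sub1set coloop.
    rewrite cardsU1 inE (card B BBs) rE addn0 cardsE.
    rewrite (card_uniqP _); last by apply: take_uniq; move: us; rewrite /s cats0.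
    rewrite size_takel // (contra _ es) ?add1n ?ltnn // => /mem_take es1.
    by rewrite mem_cat es1.
  have [||||||h' hE hn] := IH c r' s1 [::] (contraction e Bs) => //.
    exact: free_contraction.
  apply: final hE _ => /=; rewrite (uniform_h_small small) mulr0 addr0.
  rewrite big_nil !mulr1 in hn *.
  rewrite addrAC -mulrBr rpredD // rpredM ?nneg_geom ?nneg_X //.
(* The coloop [e] is exchanged for [x], the head of the free parts: [x] joins [s1], [c.+1] is kept,
   and [uniform_h_exchange] compares the two products. *)
have [||||||h' hE hn] := IH c.+1 r' (rcons s1 x) s2 (contraction e Bs);
  rewrite ?cat_rcons //.
- by rewrite r'E /= addnS.
- exact: free_coloop.
- rewrite cat_rcons in hE; apply: final hE _.
  rewrite big_cons; set P := \prod_(e <- s2) _ in hn *.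
  set u := uniform_h c.+1 (rcons s1 x) in hn *.
  rewrite (_ : _ - _ = geom (b e) * (h' - u * P) + 'X^(b e) * h''
    + (geom (b e) * u - uniform_h c.+1 (e :: s1) * geom (b x)) * P); last by ring.
  rewrite !rpredD // rpredM ?nneg_geom ?nneg_X ?pos2 //.
  by apply/uniform_h_exchange/maxe; rewrite mem_cat inE eqxx orbT.
Qed.

End Bases.

(** The predicate describes the spanning sets of the comparison matroid, so the bound of
    [weighted_sum_bound] is attained there. *)
Lemma weighted_sum_min (T : finType) (b : T -> nat) c (s1 s2 : seq T) :
  uniq (s1 ++ s2) ->
  weighted_sum b (s1 ++ s2)
      (fun W => (c <= count (mem W) s1)%N && all (mem W) s2) =
    (1 - 'X) ^+ (c + size s2) * (uniform_h b c s1 * \prod_(e <- s2) geom (b e)).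
Proof.
elim: s1 c => [|e s1 IH] c.
  rewrite cat0s; case: c => [|c] us /=; last first.
    by rewrite mul0r mulr0 -(weighted_sum0 b s2); apply: eq_weighted_sum.
  rewrite mul1r add0n; elim: s2 us => [|e s2 IH] /=.
    by rewrite big_nil mulr1.
  move=> /andP[es us]; rewrite (@eq_weighted_sum _ _ _ _ (fun W => all (mem W) s2)).
    rewrite IH // (@eq_weighted_sum _ _ _ _ pred0).
      by rewrite weighted_sum0 big_cons subr_exprX_geom exprS; ring.
    move=> W sW /=; rewrite (_ : e \in W = false) //.
    by apply: contraNF es; exact: (subsetP sW).
  move=> W sW /=; rewrite setU11 /=; apply: eq_in_all => x xs /=.
  by rewrite !inE; case: eqP => // xe; rewrite -xe xs in es.
rewrite cat_cons cons_uniq => /andP[es us] /=.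
have es1 : e \notin s1 by apply: contra es; rewrite mem_cat => ->.
have es2 : e \notin s2 by apply: contra es; rewrite mem_cat orbC => ->.
have U (s : seq T) W : e \notin s -> {in s, mem (e |: W) =1 mem W}.
  by move=> es' x xs /=; rewrite !inE; case: eqP => // xe; rewrite -xe xs in es'.
have notin (W : {set T}) : W \subset s1 ++ s2 -> (e \in W) = false.
  by move=> sW; apply: contraNF es; exact: (subsetP sW).
rewrite (@eq_weighted_sum _ _ _ _
  (fun W => (c <= (count (mem W) s1).+1)%N && all (mem W) s2)); last first.
  move=> W sW /=; rewrite setU11 /= add1n.
  by rewrite (eq_in_count (U _ _ es1)) (eq_in_all (U _ _ es2)).
rewrite [X in _ + _ * X](@eq_weighted_sum _ _ _ _
  (fun W => (c <= count (mem W) s1)%N && all (mem W) s2)); last first.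
  by move=> W /notin /= ->.
case: c => [|c]; rewrite !IH //.
  by rewrite uniform_h0 /=; ring.
by rewrite subr_exprX_geom !addSn !exprS; ring.
Qed.

(** * From sets of vertices to sets of parts *)

Lemma big_subsets_disjointU (R : nmodType) (V : finType) (A E : {set V})
    (f : {set V} -> R) : [disjoint A & E] ->
  \sum_(Z : {set V} | Z \subset A :|: E) f Z =
  \sum_(Z1 : {set V} | Z1 \subset A) \sum_(Z2 : {set V} | Z2 \subset E) f (Z1 :|: Z2).
Proof.
move=> dis; rewrite pair_big_dep /=.
rewrite (reindex_onto (fun p : {set V} * {set V} => p.1 :|: p.2)
   (fun Z => (Z :&: A, Z :&: E))) /=; last first.
  by move=> Z sZ; rewrite -setIUr; apply/setIidPl.
apply: eq_bigl => -[Z1 Z2] /=; apply/andP/andP => [[_ /eqP[<- <-]]|[s1 s2]].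
  by rewrite !subsetIr.
split; first exact: setUSS.
rewrite !setIUl (setIidPl s1) (setIidPl s2).
have -> : Z2 :&: A = set0.
  by apply/eqP; rewrite setI_eq0 (disjointWl s2) // disjoint_sym.
by rewrite (_ : Z1 :&: E = set0) ?setU0 ?set0U //; apply/eqP; rewrite setI_eq0 (disjointWl s1).
Qed.

Section Fibers.

Variables (V T : finType) (pi : V -> T).

(** For [Z] inside [E], this is [(1 - 'X) ^+ #|E|] times the degree series of the monomials in the
    variables of [E] whose zero set is exactly [Z]. *)
Definition zero_weight (E Z : {set V}) : {poly int} :=
  \prod_(v in E) (if v \in Z then 1 - 'X else 'X).

Lemma zero_weight0 (E : {set V}) : zero_weight E set0 = 'X^#|E|.
Proof.
by rewrite /zero_weight (eq_bigr (fun=> 'X)) ?prodr_const // => v; rewrite inE.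
Qed.

Lemma zero_weightU (A E Z1 Z2 : {set V}) : [disjoint A & E] ->
  Z1 \subset A -> Z2 \subset E ->
  zero_weight (A :|: E) (Z1 :|: Z2) = zero_weight A Z1 * zero_weight E Z2.
Proof.
move=> dis s1 s2; rewrite /zero_weight.
rewrite (eq_bigl (fun v => v \in [predU A & E])) => [|v]; last by rewrite !inE.
rewrite bigU //=; congr (_ * _).
  apply: eq_bigr => v vA; rewrite inE (_ : v \in Z2 = false) ?orbF //.
  by apply: contraTF vA => /(subsetP s2) vE; rewrite (disjointFl dis).
apply: eq_bigr => v vE; rewrite inE (_ : v \in Z1 = false) //.
by apply: contraTF vE => /(subsetP s1) vA; rewrite (disjointFr dis).
Qed.

Lemma sum_zero_weight (A : {set V}) :
  \sum_(Z : {set V} | Z \subset A) zero_weight A Z = 1.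
Proof.
(* Outside [A] the values 0 and 1 make the terms of all [Z] not contained in [A] vanish when the
   product is expanded. *)
pose F (v : V) : {poly int} := if v \in A then 1 - 'X else 0.
pose G (v : V) : {poly int} := if v \in A then 'X else 1.
transitivity (\prod_v (F v + G v)); last first.
  by rewrite big1 // => v _; rewrite /F /G; case: ifP => _; rewrite ?subrK ?add0r.
rewrite bigA_distr big_mkcond /=; apply: eq_bigr => Z _.
case: ifPn => [sZ|/subsetPn[v vZ vA]].
  rewrite /zero_weight big_mkcond; apply: eq_bigr => v _; rewrite /F /G.
  case: (boolP (v \in A)) => // vA; case: ifP => // /(subsetP sZ).
  by rewrite (negbTE vA).
by rewrite (bigD1 v) //= vZ /F (negbTE vA) mul0r.
Qed.

(** The nonempty subsets of the fibre [A] over [e] all have image [[set e]] and total weight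
    [1 - 'X^#|A|]; the empty one has weight ['X^#|A|]. These are the two terms of the recursion. *)
Lemma weighted_sum_fibers (s : seq T) (S : pred {set T}) : uniq s ->
  \sum_(Z : {set V} | Z \subset [set v | pi v \in s])
     (S (pi @: Z))%:R * zero_weight [set v | pi v \in s] Z =
  weighted_sum (fun e => #|[set v | pi v == e]|) s S.
Proof.
elim: s S => [|e s IH] S /=.
  rewrite (_ : [set v | _] = set0); last by apply/setP => v; rewrite !inE.
  rewrite (bigD1 set0) ?sub0set //= big1 ?addr0.
    by rewrite imset0 /zero_weight big_set0 mulr1.
  by move=> Z /andP[]; rewrite subset0 => ->.
move=> /andP[es us]; set A := [set v | pi v == e]; set E := [set v | pi v \in s].
have -> : [set v | pi v \in e :: s] = A :|: E by apply/setP => v; rewrite !inE.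
have dis : [disjoint A & E].
  rewrite -setI_eq0; apply/eqP/setP => v; rewrite !inE.
  by case: eqP => // ->; rewrite (negbTE es).
rewrite big_subsets_disjointU // (bigD1 set0) ?sub0set //= addrC; congr (_ + _).
  have wA : \sum_(Z : {set V} | (Z \subset A) && (Z != set0)) zero_weight A Z
      = 1 - 'X^#|A|.
    rewrite -(sum_zero_weight A) [in RHS](bigD1 set0) ?sub0set //= addrAC.
    by rewrite zero_weight0 subrr add0r.
  rewrite -wA -IH // mulr_suml; apply: eq_bigr => Z1 /andP[s1 /set0Pn[v vZ1]].
  rewrite mulr_sumr; apply: eq_bigr => Z2 s2; rewrite zero_weightU // mulrCA.
  congr (_ * _); rewrite imsetU (_ : pi @: Z1 = [set e]) //.
  apply/setP => x; rewrite inE; apply/imsetP/eqP => [[w /(subsetP s1)]|->].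
    by rewrite inE => /eqP-> ->.
  by exists v => //; move: (subsetP s1 v vZ1); rewrite inE => /eqP.
rewrite -IH // mulr_sumr; apply: eq_bigr => Z2 s2.
by rewrite zero_weightU ?sub0set // set0U mulrCA zero_weight0.
Qed.

End Fibers.

(** * Hilbert functions of cover ideals *)

Section MonomialIdeals.

Variables (n : nat) (k : fieldType).
Implicit Types (f g : {mpoly k[n]}) (m : 'X_{1..n}) (F : {set 'I_n}).
Implicit Types (Delta : {set {set 'I_n}}).

Definition zeros m : {set 'I_n} := [set i | m i == 0%N].

Lemma mcoeffMU_eq0 g m i : m i = 0%N -> (g * 'X_i)@_m = 0.
Proof.
move=> mi; apply: memN_msupp_eq0; rewrite (perm_mem (msuppMX g U_(i)%MM)).
apply/mapP => -[m' _ mE]; move: mi.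
by rewrite mE mnmDE mnm1E eqxx.
Qed.

Lemma var_idealP F f :
  var_ideal F f <-> forall m, m \in msupp f -> ~~ (F \subset zeros m).
Proof.
split=> [[g ->] m|fF].
  rewrite mcoeff_msupp; apply: contraNN => /subsetP sF.
  rewrite raddf_sum /= big1 // => i /sF; rewrite inE => /eqP.
  exact: mcoeffMU_eq0.
(* Each monomial of the support is charged to one variable of [F] dividing it; the terms charged to
   [i] form the cofactor of ['X_i]. *)
pose pk m := [pick i | (i \in F) && (m i != 0%N)].
exists (fun i => \sum_(m <- msupp f | pk m == Some i) f@_m *: 'X_[(m - U_(i))%MM]).
rewrite [LHS]mpolyE; transitivity
  (\sum_(i in F) \sum_(m <- msupp f | pk m == Some i) f@_m *: 'X_[m] : {mpoly k[n]}).
  rewrite (exchange_big_dep xpredT) //= big_seq [RHS]big_seq.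
  apply: eq_bigr => m /fF /subsetPn[i iF]; rewrite inE => mi.
  rewrite /pk; case: pickP => [i0 /andP[i0F mi0]|/(_ i)]; last by rewrite iF mi.
  rewrite (big_pred1 i0) // => x /=; rewrite andbC.
  by apply/andP/eqP => [[/eqP[->]]|->].
apply: eq_bigr => i iF; rewrite mulr_suml; apply: eq_bigr => m.
rewrite /pk; case: pickP => // i0 /andP[_ mi0] /eqP[<-].
rewrite -scalerAl -mpolyXD submK //.
by apply/mnm_lepP => l; rewrite mnm1E; case: eqP => // <-; rewrite lt0n.
Qed.

Lemma cover_idealP Delta f :
  cover_ideal Delta f <->
  forall m, m \in msupp f -> ~~ spans (facets Delta) (zeros m).
Proof.
split=> [cf m mf|cf F FF].
  by apply/existsP => -[F /andP[/cf/var_idealP/(_ m mf)/negP]].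
apply/var_idealP => m /cf; apply: contra => sF.
by apply/existsP; exists F; rewrite FF.
Qed.

(** As [epsilon] returns an unspecified graded dimension, uniqueness is needed besides existence.
    The coefficient matrix [M] of any basis is row free by independence and row full by generation,
    hence square. *)
Lemma hilbert_funE (I : {mpoly k[n]} -> Prop) j N (mon : 'I_N -> 'X_{1..n}) :
  injective mon -> (forall b, mdeg (mon b) = j) ->
  (forall f, f \is j.-homog -> I f <-> forall b, f@_(mon b) = 0) ->
  hilbert_fun I j = N.
Proof.
move=> monI degm IE.
have homX b : ('X_[mon b] : {mpoly k[n]}) \is j.-homog by rewrite dhomogX; apply/eqP; exact: degm.
have hom_sum (m : nat) (h : 'I_m -> {mpoly k[n]}) c :
    (forall i, h i \is j.-homog) -> \sum_i c i *: h i \is j.-homog.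
  by move=> hh; apply: rpred_sum => i _; apply: rpredZ.
have uniq_dim (m : nat) : is_graded_dim I j m -> m = N.
  case=> h [hh free full]; pose M := \matrix_(i < m, b < N) (h i)@_(mon b).
  have ME (u : 'rV_m) b : (u *m M) 0 b = (\sum_i u 0 i *: h i)@_(mon b).
    rewrite mxE raddf_sum; apply: eq_bigr => i _.
    by rewrite /= mcoeffZ mxE.
  have /eqP <- : row_free M.
    apply: inj_row_free => u uM; apply/rowP => i; rewrite mxE.
    apply: (free (fun i => u 0 i)); apply/IE; first exact: hom_sum.
    by move=> b; rewrite -ME uM mxE.
  apply/eqP; rewrite -[_ == _]/(row_full M) -sub1mx; apply/row_subP => b.
  have [c /IE Ic] := full _ (homX b); apply/submxP; exists (\row_i c i).
  apply/rowP => b'; rewrite ME row1 mxE eqxx /=; apply/esym/eqP.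
  rewrite (eq_bigr (fun i => c i *: h i)); last by move=> i _; rewrite mxE.
  have := Ic _ b'; rewrite mcoeffB mcoeffX (inj_eq monI) eq_sym.
  move/(_ _)/eqP; rewrite subr_eq0 eq_sym; apply.
  by rewrite rpredB ?homX ?hom_sum.
apply: uniq_dim; apply: epsilon_spec; exists N, (fun b => 'X_[mon b]).
have coefE (c : 'I_N -> k) b : (\sum_i c i *: 'X_[mon i])@_(mon b) = c b.
  rewrite raddf_sum (bigD1 b) //= big1 => [|i ib].
    by rewrite addr0 mcoeffZ mcoeffX eqxx mulr1.
  by rewrite mcoeffZ mcoeffX (inj_eq monI) (negbTE ib) mulr0.
split=> // [c /IE Ic i|g gh].
  by rewrite -(coefE c i) Ic // hom_sum.
exists (fun b => g@_(mon b)); apply/IE; first by rewrite rpredB ?hom_sum.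
by move=> b; rewrite mcoeffB coefE subrr.
Qed.

(** Exponents below [T] give a finite type to count in; it covers every monomial of degree less than
    [T]. *)
Definition bounded_mon T (e : {ffun 'I_n -> 'I_T}) : 'X_{1..n} :=
  [multinom val (e i) | i < n].

Lemma bounded_mon_inj T : injective (@bounded_mon T).
Proof.
move=> e e' /mnmP eE; apply/ffunP => i; apply: val_inj.
by move: (eE i); rewrite !mnmE.
Qed.

Lemma bounded_monP T m : (forall i, m i < T)%N -> exists e, m = @bounded_mon T e.
Proof.
move=> mT; exists [ffun i => Ordinal (mT i)].
by apply/mnmP => i; rewrite mnmE ffunE.
Qed.

Definition ffun_zeros T (e : {ffun 'I_n -> 'I_T}) : {set 'I_n} :=
  [set i | val (e i) == 0%N].

Lemma zeros_bounded_mon T (e : {ffun 'I_n -> 'I_T}) :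
  zeros (bounded_mon e) = ffun_zeros e.
Proof. by apply/setP => i; rewrite !inE mnmE. Qed.

Lemma mdeg_bounded_mon T (e : {ffun 'I_n -> 'I_T}) :
  mdeg (bounded_mon e) = (\sum_i val (e i))%N.
Proof. by rewrite mdegE; apply: eq_bigr => i _; rewrite mnmE. Qed.

Lemma hilbert_fun_cover Delta T j : (j < T)%N ->
  hilbert_fun (@cover_ideal n k Delta) j =
  #|[set e : {ffun 'I_n -> 'I_T} | spans (facets Delta) (ffun_zeros e)
       & (\sum_i val (e i) == j)%N]|.
Proof.
move=> jT; set E := [set e | _ & _].
apply: (@hilbert_funE _ _ _ (fun b : 'I_#|E| => bounded_mon (enum_val b))).
- by move=> b b' /bounded_mon_inj /enum_val_inj.
- by move=> b; rewrite mdeg_bounded_mon; apply/eqP; move: (enum_valP b); rewrite inE => /andP[].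
move=> f fj; rewrite cover_idealP; split=> [cf b|cf m mf].
  apply/eqP; rewrite mcoeff_eq0; apply: contraL (enum_valP b) => /cf.
  by rewrite zeros_bounded_mon inE negb_and => ->.
have dm : mdeg m = j by move/dhomogP: fj => /(_ m mf).
have [i|e mE] := @bounded_monP T m.
  by apply: leq_ltn_trans jT; rewrite -dm mdegE (bigD1 i) //= leq_addr.
apply: contraL mf => sm; rewrite -mcoeff_eq0 mE; apply/eqP.
have eE : e \in E.
  by rewrite inE -zeros_bounded_mon -mE sm -mdeg_bounded_mon -mE dm eqxx.
by have := cf (enum_rank_in eE e); rewrite enum_rankK_in.
Qed.

End MonomialIdeals.

(** * Truncated Hilbert series and the h-vector *)

Definition bounded_series n T (S : pred {set 'I_n}) : {poly int} :=
  \sum_(e : {ffun 'I_n -> 'I_T} | S (ffun_zeros e)) 'X^(\sum_i val (e i)).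

Lemma hilbert_fun_series n (k : fieldType) (Delta : {set {set 'I_n}}) T j :
  (j < T)%N ->
  (hilbert_fun (@cover_ideal n k Delta) j)%:Z = (bounded_series T (spans (facets Delta)))`_j.
Proof.
move=> jT; rewrite (hilbert_fun_cover _ _ jT) /bounded_series coef_sum -sum1_card.
rewrite -natz natr_sum.
rewrite (eq_bigl (fun e : {ffun 'I_n -> 'I_T} => spans (facets Delta) (ffun_zeros e)
   && (\sum_i val (e i) == j)%N)); last by move=> e; rewrite inE.
by rewrite big_mkcondr /=; apply: eq_bigr => e _; rewrite coefXn eq_sym; case: eqP.
Qed.

(** Group the exponent vectors by zero set: a nonzero coordinate runs over 1 to [T] and contributes
    ['X - 'X^(T.+1)] after multiplication by [1 - 'X]. *)
Lemma bounded_seriesE n T (S : pred {set 'I_n}) :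
  (1 - 'X) ^+ n * bounded_series T.+1 S =
  \sum_(Z : {set 'I_n}) (S Z)%:R * \prod_i (if i \in Z then 1 - 'X else 'X - 'X^(T.+1)).
Proof.
rewrite /bounded_series (partition_big (@ffun_zeros n T.+1) xpredT) //= mulr_sumr.
apply: eq_bigr => Z _; case SZ: (S Z); last first.
  rewrite mul0r big_pred0 ?mulr0 // => e.
  by apply/andP => -[Se /eqP eZ]; rewrite eZ SZ in Se.
rewrite mul1r (eq_bigl (fun e => e \in family (fun i (x : 'I_T.+1) =>
  (val x == 0%N) == (i \in Z)))); last first.
  move=> e; apply/andP/familyP => [[_ /eqP <-] i|eZ].
    by rewrite -topredE /= inE.
  have -> : ffun_zeros e = Z.
    by apply/setP => i; rewrite inE; have := eZ i; rewrite unfold_in => /eqP.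
  by rewrite SZ.
rewrite (eq_bigr (fun e : {ffun 'I_n -> 'I_T.+1} => \prod_i 'X^(e i))); last first.
  by move=> e _; rewrite expr_sum.
rewrite -(bigA_distr_big_dep (fun i (x : 'I_T.+1) => (val x == 0%N) == (i \in Z))
  (fun i x => 'X^x)) -{1}[n]card_ord -prodr_const -big_split /=.
apply: eq_bigr => i _; case: (i \in Z).
  by rewrite (big_pred1 ord0) ?expr0 ?mulr1 // => x; rewrite eqb_id.
rewrite big_mkcond big_ord_recl /= add0r.
rewrite (eq_bigr (fun x : 'I_T => 'X * 'X^x)); last by move=> x _; rewrite /bump add1n exprS.
by rewrite -mulr_sumr mulrCA -[\sum_i _]/(geom T) -subr_exprX_geom mulrBr mulr1 -exprS.
Qed.

(** Congruence modulo ['X^T], in which [1 - 'X] is a unit; it absorbs the error of the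
    truncation. *)
Definition coef_eq_below T (p q : {poly int}) := forall i, (i < T)%N -> p`_i = q`_i.

Lemma coef_eq_belowM T p p' q q' :
  coef_eq_below T p p' -> coef_eq_below T q q' -> coef_eq_below T (p * q) (p' * q').
Proof.
move=> hp hq i iT; rewrite !coefM; apply: eq_bigr => l _.
rewrite hp ?hq //; first exact: leq_ltn_trans (leq_subr _ _) iT.
by apply: leq_ltn_trans iT; rewrite -ltnS.
Qed.

Lemma coef_eq_below_cancel T d p q :
  coef_eq_below T ((1 - 'X) ^+ d * p) ((1 - 'X) ^+ d * q) -> coef_eq_below T p q.
Proof.
elim: d => [|d IH]; first by rewrite !expr0 !mul1r.
rewrite exprS -!mulrA => h; apply: IH; move: h.
move: (_ * p) (_ * q) => {}p {}q h; elim=> [|i IH] iT.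
  by have := h 0%N iT; rewrite !mulrBl !mul1r !coefB !coefXM !subr0.
have := h _ iT; rewrite !mulrBl !mul1r !coefB !coefXM /= IH ?(ltnW iT) //.
exact: addIr.
Qed.

Lemma h_vectorE n (k : fieldType) (Delta : {set {set 'I_n}}) d (h : {poly int}) :
  (d <= n)%N -> krull_dim (@cover_ideal n k Delta) = (n - d)%N ->
  (1 - 'X) ^+ d * h =
    \sum_(Z : {set 'I_n}) (spans (facets Delta) Z)%:R * zero_weight setT Z ->
  forall j, h_vector k Delta j = h`_j.
Proof.
move=> dn kd hE j; set H := bounded_series j.+1 (spans (facets Delta)).
have -> : h_vector k Delta j = ((1 - 'X) ^+ (n - d) * H)`_j.
  rewrite /h_vector /h_coef kd coefM; apply: eq_bigr => i _; congr (_ * _).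
  by apply: hilbert_fun_series; rewrite ltnS leq_subr.
(* Multiplying by [(1 - 'X) ^+ d] completes the exponent to [n], as [bounded_seriesE] requires; its
   tails ['X^(j.+1)] do not affect coefficient [j]. *)
suff /coef_eq_below_cancel : coef_eq_below j.+1
  ((1 - 'X) ^+ d * ((1 - 'X) ^+ (n - d) * H)) ((1 - 'X) ^+ d * h) by apply.
rewrite mulrA -exprD subnKC // bounded_seriesE hE => i ij; rewrite !coef_sum.
apply: eq_bigr => Z _; apply: (@coef_eq_belowM j.+1) => //.
rewrite /zero_weight [X in coef_eq_below _ _ X](eq_bigl xpredT); last by move=> v; rewrite inE.
apply: (big_ind2 (coef_eq_below j.+1)) => // [*|v _]; first exact: coef_eq_belowM.
case: ifP => // _ l lj; rewrite coefB [X in _ - X]coefXn.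
by rewrite (ltn_eqF lj) subr0.
Qed.

(** * Krull dimension of cover ideals *)

Section PrimeChains.

Variables (n : nat) (k : fieldType).
Local Notation S := {mpoly k[n]}.
Implicit Types (f g : S) (P : {pred S}).

Lemma idealr_mul P a f : idealr_closed P -> f \in P -> a * f \in P.
Proof. by case=> P0 _ PD fP; rewrite -[_ * _]addr0 PD. Qed.

Lemma idealr_add P f g : idealr_closed P -> f \in P -> g \in P -> f + g \in P.
Proof. by case=> _ _ PD fP gP; rewrite -[f]mul1r PD. Qed.

Lemma idealr_sum (K : finType) (Q : pred K) (F : K -> S) P : idealr_closed P ->
  (forall i, Q i -> F i \in P) -> \sum_(i | Q i) F i \in P.
Proof.
move=> idlP FP; apply: (big_ind (fun f => f \in P)) => //; first by case: idlP.
by move=> f g; apply: idealr_add.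
Qed.

Lemma prime_cancel_expr P x f m : prime_idealr_closed P -> x \notin P ->
  x ^+ m * f \in P -> f \in P.
Proof.
move=> prP xP; elim: m => [|m IH]; first by rewrite expr0 mul1r.
by rewrite exprS -mulrA => /prP; rewrite (negbTE xP) /=.
Qed.

(* Keeping at each step the terms of least exponent in the next [x i], divide
   by that power of [x i] modulo [P i] and set [x i] to zero modulo [P i.+1]:
   the last relation is a nonzero constant in [P l]. *)
Lemma prime_chain_independent l (K : finType) (c : K -> k) (e : K -> nat -> nat)
    (x : nat -> S) (P : nat -> {pred S}) :
  (forall i, (i <= l)%N -> idealr_closed (P i)) ->
  (forall i, (i <= l)%N -> prime_idealr_closed (P i)) ->
  (forall i, (i < l)%N -> {subset P i <= P i.+1}) ->
  (forall i, (i < l)%N -> (x i \notin P i) && (x i \in P i.+1)) ->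
  (forall a b, (forall i, (i < l)%N -> e a i = e b i) -> a = b) ->
  \sum_a c a *: \prod_(0 <= i < l) x i ^+ e a i \in P 0%N ->
  forall a, c a = 0.
Proof.
move=> idlP prP subP xP e_inj rel a0; apply/eqP; apply/negPn/negP => ca0.
suff step i : (i <= l)%N -> exists A : {set K},
    [/\ A != set0, {in A, forall a, c a != 0},
        {in A &, forall a b j, (j < i)%N -> e a j = e b j} &
        \sum_(a in A) c a *: \prod_(i <= j < l) x j ^+ e a j \in P i].
  have [A [/set0Pn[a aA] cA eA]] := step l (leqnn l).
  have -> : A = [set a].
    apply/setP => b; rewrite inE; apply/idP/eqP => [bA|-> //].
    by apply: e_inj => i; exact: eA.
  rewrite big_set1 big_geq // => /(idealr_mul ((c a)^-1)%:MP (idlP l (leqnn l))).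
  rewrite -mul_mpolyC mulr1 -mpolyCM mulVf ?cA //.
  by case: (idlP l (leqnn l)) => _ /negbTE ->.
elim: i => [_|i IH il].
  exists [set a | c a != 0]; split; first by apply/set0Pn; exists a0; rewrite inE.
  - by move=> a; rewrite inE.
  - by [].
  rewrite (bigID (fun a => c a != 0)) /= [X in _ + X]big1 ?addr0 in rel.
    by rewrite (eq_bigl (fun a => c a != 0)) // => a; rewrite inE.
  by move=> a; rewrite negbK => /eqP->; rewrite scale0r.
have [A [/set0Pn[a1 a1A] cA eA relA]] := IH (ltnW il).
have [a aA minA] := @arg_minnP _ a1 (fun a => a \in A) (fun a => e a i) a1A.
have idlP1 := idlP _ il.
exists [set b in A | e b i == e a i]; split.
- by apply/set0Pn; exists a; rewrite inE aA eqxx.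
- by move=> b; rewrite inE => /andP[/cA].
- move=> b b'; rewrite !inE => /andP[bA /eqP bi] /andP[b'A /eqP b'i] j.
  rewrite ltnS leq_eqVlt => /orP[/eqP->|]; first by rewrite bi b'i.
  exact: eA.
have /andP[xPi xPi1] := xP i il.
pose y b := c b *: \prod_(i.+1 <= j < l) x j ^+ e b j.
have : x i ^+ e a i * \sum_(b in A) x i ^+ (e b i - e a i) * y b \in P i.
  rewrite mulr_sumr (eq_bigr (fun b => c b *: \prod_(i <= j < l) x j ^+ e b j)) //.
  move=> b bA; rewrite mulrA -exprD subnKC ?minA // /y -scalerAr.
  by rewrite [in RHS]big_ltn.
move/(prime_cancel_expr (prP i (ltnW il)) xPi)/(subP i il).
rewrite (bigID (fun b => e b i == e a i)) /= => rel1.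
have rest : \sum_(b in A | e b i != e a i) x i ^+ (e b i - e a i) * y b \in P i.+1.
  apply: idealr_sum => // b /andP[bA ne].
  have lt : (e a i < e b i)%N by rewrite ltn_neqAle eq_sym ne minA.
  rewrite -(ltn_predK (m := 0%N) (n := e b i - e a i)%N) ?subn_gt0 // exprS -mulrA mulrC.
  exact: idealr_mul.
have -> : \sum_(b in [set b in A | e b i == e a i]) y b =
    -1 * (\sum_(b in A | e b i != e a i) x i ^+ (e b i - e a i) * y b)
    + (\sum_(b in A | e b i == e a i) x i ^+ (e b i - e a i) * y b
       + \sum_(b in A | e b i != e a i) x i ^+ (e b i - e a i) * y b).
  rewrite mulN1r addrC addrK; apply: eq_big => [b|b]; first by rewrite inE.
  by rewrite inE => /andP[_ /eqP->]; rewrite subnn mul1r.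
by case: idlP1 => _ _; apply.
Qed.

Lemma mdeg_prod_expr (l : nat) (x : 'I_l -> S) (e : 'I_l -> nat) D N m :
  (forall i, (msize (x i) <= D)%N) -> (forall i, (e i <= N)%N) ->
  m \in msupp (\prod_i x i ^+ e i) -> (mdeg m <= l * (N * D))%N.
Proof.
move=> xD eN; pose Q B f := forall m, m \in msupp f -> (mdeg m <= B)%N.
have QM B B' f g : Q B f -> Q B' g -> Q (B + B')%N (f * g).
  move=> Qf Qg m' /msuppM_le /allpairsP[[m1 m2] /= [/Qf h1 /Qg h2 ->]].
  by rewrite mdegD leq_add.
have Q1 : Q 0%N 1 by move=> m'; rewrite msupp1 inE => /eqP->; rewrite mdeg0.
have QX i : Q (N * D)%N (x i ^+ e i).
  suff Qe a : Q (a * D)%N (x i ^+ a).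
    by move=> m' /Qe h; apply: leq_trans h _; rewrite leq_mul2r eN orbT.
  elim: a => [|a IH]; first by rewrite expr0.
  rewrite exprS mulSn; apply: QM => // m' /msize_mdeg_lt h.
  exact: ltnW (leq_trans h (xD i)).
have : Q (\sum_(i < l) N * D)%N (\prod_i x i ^+ e i).
  by apply: (big_ind2 (fun B f => Q B f)) => // B f B' g; exact: QM.
by rewrite sum_nat_const card_ord; apply.
Qed.

End PrimeChains.

(** * Primes generated by variables *)

Section KillVariables.

Variables (n : nat) (k : fieldType).
Implicit Types (f : {mpoly k[n]}) (G : {set 'I_n}).

(** An endomorphism whose kernel is the ideal of the variables in [G]; this ideal is prime because
    the target is a domain. *)
Definition kill G f : {mpoly k[n]} :=
  f \mPo [tuple (if i \in G then 0 else 'X_i) | i < n].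

Lemma killX G m :
  kill G 'X_[m] = if G \subset zeros m then 'X_[m] else 0.
Proof.
rewrite /kill comp_mpolyX; case: ifPn => [/subsetP sG|/subsetPn[i iG]].
  rewrite [RHS]mpolyXE_id; apply: eq_bigr => i _; rewrite tnth_mktuple.
  by case: ifP => // /sG; rewrite inE => /eqP->; rewrite !expr0.
rewrite inE => mi; rewrite (bigD1 i) //= tnth_mktuple iG expr0n (negbTE mi).
by rewrite mul0r.
Qed.

Lemma mcoeff_kill G f m :
  (kill G f)@_m = if G \subset zeros m then f@_m else 0.
Proof.
rewrite /kill comp_mpolyEX raddf_sum /=.
rewrite (eq_bigr (fun m' => (if G \subset zeros m then 1 else 0)
  * (f@_m' *: 'X_[m'] : {mpoly k[n]})@_m)) => [|m' _].
  by rewrite -mulr_sumr -raddf_sum -mpolyE; case: ifP; rewrite ?mul1r ?mul0r.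
rewrite -/(kill G 'X_[m']) killX !mcoeffZ.
case: (eqVneq m' m) => [->|ne].
  by case: ifP => _; rewrite ?mul1r // mcoeff0 mulr0 mul0r.
by rewrite [in RHS]mcoeffX (negbTE ne); case: ifP => _;
  rewrite ?mcoeffX ?(negbTE ne) ?mcoeff0 !mulr0.
Qed.

Lemma killU G i : kill G 'X_i = if i \in G then 0 else 'X_i.
Proof. by rewrite /kill comp_mpolyXU -tnth_nth tnth_mktuple. Qed.

Lemma kill_eq0P G f : reflect (var_ideal G f) (kill G f == 0).
Proof.
apply: (iffP eqP) => [f0|/var_idealP fG].
  apply/var_idealP => m; rewrite mcoeff_msupp; apply: contraNN => sG.
  by have := mcoeff_kill G f m; rewrite f0 mcoeff0 sG => <-.
apply/mpolyP => m; rewrite mcoeff_kill mcoeff0; case: ifP => // sG.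
by apply: memN_msupp_eq0; apply: contraL sG => /fG.
Qed.

Lemma kill_subset G G' f : G \subset G' -> kill G f == 0 -> kill G' f == 0.
Proof.
move=> sG /eqP f0; apply/eqP/mpolyP => m; rewrite mcoeff_kill mcoeff0.
case: ifP => // sG'; have := mcoeff_kill G f m.
by rewrite f0 mcoeff0 (subset_trans sG sG').
Qed.

Lemma kill_idealr_closed G : idealr_closed [pred f | kill G f == 0].
Proof.
split; rewrite ?inE /kill ?raddf0 ?rmorph1 ?oner_eq0 //.
move=> a u v; rewrite !inE /kill => /eqP u0 /eqP v0.
by rewrite rmorphD rmorphM /= u0 v0 mulr0 addr0.
Qed.

Lemma kill_prime G : prime_idealr_closed [pred f | kill G f == 0].
Proof. by move=> u v; rewrite !inE /kill rmorphM mulf_eq0. Qed.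

End KillVariables.

Section CoverDimension.

Variables (n : nat) (k : fieldType) (Delta : {set {set 'I_n}}) (d : nat).
Hypothesis (facets_card : forall F, F \in facets Delta -> #|F| = d).

Lemma card_vanishing_exponents T (F : {set 'I_n}) :
  #|[set e : {ffun 'I_n -> 'I_T.+1} | F \subset ffun_zeros e]| = (T.+1 ^ (n - #|F|))%N.
Proof.
have -> : (n - #|F|)%N = #|~: F| by rewrite [#|~: F|]cardsCs setCK card_ord.
rewrite -[X in (X ^ _)%N]card_ord -(card_pffun_on (ord0 : 'I_T.+1)) cardsE.
apply: eq_card => e; rewrite inE; apply/idP/pffun_onP => [sF|[sup _]].
  split=> //; apply/subsetP => i; rewrite !inE; apply: contraNN => /(subsetP sF).
  by rewrite inE => /eqP ei; apply/eqP/val_inj.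
apply/subsetP => i iF; rewrite inE; apply/eqP; apply: contraTeq iF => ei.
by have := subsetP sup i; rewrite !inE; apply; apply: contraNneq ei => ->.
Qed.

(** A union bound over the facets: the count grows at most like the power [n - d] of the exponent
    bound. *)
Lemma card_spanning_exponents T :
  (#|[set e : {ffun 'I_n -> 'I_T.+1} | spans (facets Delta) (ffun_zeros e)]|
    <= #|facets Delta| * T.+1 ^ (n - d))%N.
Proof.
rewrite -sum_nat_const.
have -> : (\sum_(F in facets Delta) T.+1 ^ (n - d) =
    \sum_(F in facets Delta) \sum_(e : {ffun 'I_n -> 'I_T.+1} | F \subset ffun_zeros e) 1)%N.
  apply: eq_bigr => F FF; rewrite -(facets_card FF) -card_vanishing_exponents -sum1_card.
  by apply: eq_bigl => e; rewrite inE.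
rewrite (exchange_big_dep xpredT) //= -sum1_card big_mkcond /=.
apply: leq_sum => e _; rewrite inE; case: ifP => // /existsP[F /andP[FF sF]].
by rewrite (bigD1 F) //= FF.
Qed.

(** A chain that is too long yields elements [x i] with more bounded power products than there are
    monomials outside the cover ideal in the relevant range. A nontrivial combination then lies in
    the ideal, against [prime_chain_independent]. *)
Lemma prime_chain_cover_leq l :
  prime_chain (@cover_ideal n k Delta) l -> (l <= n - d)%N.
Proof.
rewrite leqNgt => Pl; apply/negP => lt; case: l => // l in Pl lt.
case: Pl => P [idlP prP IP subP].
have /fin_all_exists[x xP] (i : 'I_l.+1) : exists f : {mpoly k[n]},
    (f \notin P (inord i)) && (f \in P (inord i.+1)).
  have [] := subP (inord i) (inord i.+1); first by have ? := ltn_ord i; rewrite !inordK; lia.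
  move=> _ no; apply: NNPP => noex; apply: no => f fP; apply: contraPT noex => fnP H.
  by apply: H; exists f; rewrite fnP.
pose D := (\sum_i msize (x i))%N.
have xD i : (msize (x i) <= D)%N by rewrite /D (bigD1 i) //= leq_addr.
(* Since [T.+1] is at most [(l.+1 * D).+1 * N.+1], this [N] gives at most [N * N.+1 ^ (n - d)]
   monomials, fewer than the [N.+1 ^ l.+1] products. *)
pose N := (#|facets Delta| * (l.+1 * D).+1 ^ (n - d))%N.
pose T := (l.+1 * (N * D))%N.
pose K := {ffun 'I_l.+1 -> 'I_N.+1}; pose E : {set {ffun 'I_n -> 'I_T.+1}} :=
  [set e | spans (facets Delta) (ffun_zeros e)].
pose y (e : K) : {mpoly k[n]} := \prod_i x i ^+ e i.
have cardEK : (#|E| < #|K|)%N.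
  rewrite card_ffun !card_ord; apply: leq_ltn_trans (card_spanning_exponents T) _.
  apply: (@leq_trans (N.+1 ^ (n - d).+1)%N); last exact: leq_pexp2l.
  rewrite expnS; apply: (@leq_ltn_trans (N * N.+1 ^ (n - d))%N); last first.
    by rewrite ltn_mul2r expn_gt0 ltnSn.
  rewrite -mulnA leq_mul2l -expnMn; apply/orP; right.
  case: (posnP (n - d)) => [->//|r0]; rewrite leq_exp2r // /T mulnA mulnAC.
  suff H a b : ((a * b).+1 <= a.+1 * b.+1)%N by exact: H.
  by nia.
(* With more rows than columns there is a nonzero left kernel vector: a combination of the products
   without monomials outside the cover ideal. *)
pose A := \matrix_(r < #|K|, s < #|E|) (y (enum_val r))@_(bounded_mon (enum_val s)).
have /rowV0Pn[u /sub_kermxP uA u0] : kermx A != 0.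
  rewrite kermx_eq0 /row_free neq_ltn; apply/orP; left.
  by apply: leq_ltn_trans cardEK; exact: rank_leq_col.
pose c (e : K) := u 0 (enum_rank e).
have IE : cover_ideal Delta (\sum_e c e *: y e).
  apply/cover_idealP => m mf.
  have [i|e mE] := @bounded_monP n T.+1 m.
    rewrite ltnS; apply: (@leq_trans (mdeg m)); first by rewrite mdegE (bigD1 i) //= leq_addr.
    have [e _ me] : exists2 e, true & m \in msupp (y e).
      move/msupp_sum_le: mf => /flattenP[s /mapP[e _ ->] /msuppZ_le me].
      by exists e.
    by apply: mdeg_prod_expr me => // i'; rewrite -ltnS.
  apply: contraL mf => sm; rewrite -mcoeff_eq0 raddf_sum /=; apply/eqP.
  have eE : e \in E by rewrite inE -zeros_bounded_mon -mE.
  have /matrixP/(_ 0 (enum_rank_in eE e)) := uA; rewrite !mxE => s0.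
  rewrite -[RHS]s0.
  rewrite (reindex_onto (@enum_val _ _) enum_rank) /= => [|e' _]; last exact: enum_rankK.
  apply: eq_big => [r|r _]; first by rewrite enum_valK eqxx.
  by rewrite !mxE mcoeffZ /c enum_valK enum_rankK_in // mE.
move/eqP: u0; apply; apply/rowP => r; rewrite mxE -[r]enum_valK.
pose ex (e : K) i := val (e (inord i)).
have yE e : \prod_(0 <= i < l.+1) x (inord i) ^+ ex e i = y e.
  by rewrite big_mkord; apply: eq_bigr => i _; rewrite /ex inord_val.
apply: (@prime_chain_independent _ _ l.+1 K c ex (fun i => x (inord i))
   (fun i => P (inord i))) => //.
- move=> i il; have [|] // := subP (inord i) (inord i.+1).
  by rewrite !inordK // ltnW.
- by move=> i il; have := xP (inord i); rewrite inordK.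
- move=> e e' ee'; apply/ffunP => i; apply: val_inj.
  by have := ee' i (ltn_ord i); rewrite /ex inord_val.
by under eq_bigr => e _ do rewrite yE; exact: IP.
Qed.

(** Starting from the variables of [F], the other variables are added one at a time; the variable at
    position [i] of the enumeration shows that each later ideal is strictly larger. *)
Lemma cover_prime_chain F : F \in facets Delta ->
  prime_chain (@cover_ideal n k Delta) (n - d).
Proof.
move=> FF; pose G i := F :|: [set x in take i (enum (~: F))].
exists (fun i : 'I_(n - d).+1 =>
  ([pred f : {mpoly k[n]} | kill (G i) f == 0] : {pred {mpoly k[n]}})); split.
- by move=> i; exact: kill_idealr_closed.
- by move=> i; exact: kill_prime.
- move=> i f /(_ F FF)/kill_eq0P f0; rewrite inE.
  by apply: kill_subset f0; exact: subsetUl.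
move=> i j ij; set s := enum (~: F) in G *.
have sz : size s = (n - d)%N.
  by rewrite -cardE cardsCs setCK card_ord (facets_card FF).
have iz : (i < size s)%N by rewrite sz (leq_trans ij) // -ltnS.
split=> [f|].
  rewrite !inE; apply: kill_subset; apply: setUS; apply/subsetP => x; rewrite !inE.
  by rewrite -(take_takel _ (ltnW ij)) => /mem_take.
have nth_ex (t : seq 'I_n) : uniq t -> (i < size t)%N ->
    exists2 v, v \in t & index v t = i.
  case: t => // v0 t ut it.
  by exists (nth v0 (v0 :: t) i); rewrite ?mem_nth ?index_uniq.
have [v vs] := nth_ex s (enum_uniq _) iz.
move=> vi /(_ 'X_v); rewrite !inE !killU !inE !in_take // vi ltnn ij orbT eqxx.
move: vs; rewrite mem_enum inE => /negbTE -> /(_ isT)/eqP.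
move/(congr1 (mcoeff U_(v)%MM)); rewrite mcoeffXU mcoeff0 eqxx => /eqP.
by rewrite oner_eq0.
Qed.

Lemma krull_dim_cover : facets Delta != set0 ->
  krull_dim (@cover_ideal n k Delta) = (n - d)%N.
Proof.
move=> /set0Pn[F FF].
have dimE D : is_krull_dim (@cover_ideal n k Delta) D -> D = (n - d)%N.
  case=> cD maxD; apply/eqP; rewrite eqn_leq prime_chain_cover_leq //.
  by apply: maxD; exact: cover_prime_chain FF.
apply: dimE; apply: epsilon_spec; exists (n - d)%N; split.
  exact: cover_prime_chain FF.
exact: prime_chain_cover_leq.
Qed.

End CoverDimension.

(** * The simplified matroid on the parts *)

Section MatroidFacets.

Variables (n : nat) (Delta : {set {set 'I_n}}) (d : nat).
Implicit Types F G I Z : {set 'I_n}.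
Hypotheses (mat : matroid Delta) (rankD : complex_rank Delta = d).

Lemma face_card F : F \in Delta -> (#|F| <= d)%N.
Proof. by move=> FD; rewrite -rankD; apply: leq_bigmax_cond. Qed.

Lemma face_subset F G : G \in Delta -> F \subset G -> F \in Delta.
Proof. by case: mat => -[_ sub] _ _; exact: sub. Qed.

Lemma facetsE F : (F \in facets Delta) = (F \in Delta) && (#|F| == d).
Proof.
rewrite inE; apply/maxsetP/andP => [[FD maxF]|[FD /eqP cF]]; last first.
  split=> // G GD sG; apply/esym/eqP; rewrite eqEcard sG cF.
  exact: face_card.
split=> //; rewrite eqn_leq face_card //= leqNgt; apply/negP => ltF.
have [G GD cG] : exists2 G, G \in Delta & #|G| = d.
  have D0 : (0 < #|Delta|)%N by rewrite card_gt0; apply/set0Pn; exists F.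
  have [G GD Gmax] := eq_bigmax_cond (fun G : {set 'I_n} => #|G|) D0.
  by exists G => //; rewrite -rankD /complex_rank Gmax.
case: mat => _ _ /(_ F G FD GD); rewrite cG => /(_ ltF) [i iGF iFD].
have := maxF _ iFD (subsetUr _ _) => E.
by move: iGF; rewrite -E !inE eqxx.
Qed.

(** A largest face between [I] and [I :|: F] is a facet, as it could otherwise be augmented from
    [F]. *)
Lemma facet_between I F : I \in Delta -> F \in facets Delta ->
  exists G, [/\ G \in facets Delta, I \subset G & G \subset I :|: F].
Proof.
move=> ID FF; move: (FF); rewrite facetsE => /andP[FD /eqP cF].
pose P (G : {set 'I_n}) := [&& G \in Delta, I \subset G & G \subset I :|: F].
have PI : P I by rewrite /P ID subxx subsetUl.
have [G /and3P[GD sI sG] maxG] := @arg_maxnP _ I P (fun G : {set 'I_n} => #|G|) PI.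
exists G; split=> //; rewrite facetsE GD eqn_leq face_card //= leqNgt; apply/negP => ltG.
case: mat => _ _ /(_ G F GD FD); rewrite cF => /(_ ltG) [i /[!inE] /andP[iG iF] iD].
have := maxG (i |: G); rewrite cardsU1 iG add1n /geq /= ltnn => H; apply/notF/H.
rewrite /P iD subUset sG sub1set !inE iF orbT /= andbT.
exact: subset_trans sI (subsetUr _ _).
Qed.

Lemma exists_facet I : I \in Delta -> exists2 F, F \in facets Delta & I \subset F.
Proof.
move=> ID; have [F maxF sI] := maxset_exists (P := fun G => G \in Delta) ID.
by exists F; rewrite // inE.
Qed.

Section Classes.

Variables (T : finType) (pi : 'I_n -> T).
Hypothesis pi_edge : forall u v, u != v -> ([set u; v] \in Delta) = (pi u != pi v).

Lemma face_pi_inj F : F \in Delta -> {in F &, injective pi}.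
Proof.
move=> FD u v uF vF puv; apply/eqP; apply/negPn/negP => uv.
have : [set u; v] \in Delta by apply: (face_subset FD); rewrite subUset !sub1set uF.
by rewrite pi_edge // puv eqxx.
Qed.

(** The bases of the simplification, in which each parallel class becomes one element. *)
Definition class_bases : {set {set T}} := [set pi @: (F : {set _}) | F in facets Delta].

(* A facet can be moved into [Z] one vertex at a time, along parallel classes. *)
Lemma spans_class_bases Z : spans (facets Delta) Z = spans class_bases (pi @: Z).
Proof.
apply/existsP/existsP => [[F /andP[FF sF]]|[B /andP[/imsetP[F0 F0F ->] sF0]]].
  by exists (pi @: F); rewrite imset_f // imsetS.
pose P (F : {set 'I_n}) := (F \in facets Delta) && (pi @: F \subset pi @: Z).
have P0 : P F0 by rewrite /P F0F.
have [F /andP[FF sF] minF] := @arg_minnP _ F0 P (fun F : {set 'I_n} => #|F :\: Z|) P0.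
exists F; rewrite FF /=; apply/subsetP => f fF; apply/negPn/negP => fZ.
have FD : F \in Delta by move: FF; rewrite facetsE => /andP[].
have [z zZ fz] := imsetP (subsetP sF _ (imset_f pi fF)).
have zf : z != f by apply: contraNneq fZ => <-.
have z1 : [set z] \in Delta by case: mat.
have [G [GF zG sG]] := facet_between z1 FF.
have GD : G \in Delta by move: GF; rewrite facetsE => /andP[].
rewrite sub1set in zG.
have fG : f \notin G.
  apply/negP => fG; move/eqP: zf; apply.
  by apply: (face_pi_inj GD) => //; rewrite fz.
have sub x : x \in G -> x \notin Z -> x \in F.
  by move/(subsetP sG); rewrite !inE => /orP[/eqP->|//]; rewrite zZ.
have : P G.
  rewrite /P GF; apply/subsetP => _ /imsetP[x xG ->].
  have [xZ|xZ] := boolP (x \in Z); first exact: imset_f.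
  by apply: (subsetP sF); apply: imset_f; exact: sub.
move/minF; rewrite leqNgt => /negP; apply; apply: proper_card; apply/properP; split.
  by apply/subsetP => x; rewrite !inE => /andP[xZ xG]; rewrite xZ sub.
by exists f; rewrite !inE ?fZ // negb_and fG orbT.
Qed.

Lemma class_bases_system (s : seq T) : (forall x, x \in s) ->
  basis_system d s class_bases.
Proof.
move=> sT.
have cardB F : F \in facets Delta -> #|pi @: F| = d.
  rewrite facetsE => /andP[FD /eqP <-]; exact/card_in_imset/face_pi_inj.
split.
- have [F FF _] := exists_facet (let: And3 (conj D0 _) _ _ := mat in D0).
  by apply/set0Pn; exists (pi @: F); rewrite imset_f.
- by move=> _ /imsetP[F FF ->]; exact: cardB.
- by move=> B _; apply/subsetP => x _.
move=> _ _ x /imsetP[F1 FF1 ->] /imsetP[F2 FF2 ->].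
rewrite inE => /andP[xF2 /imsetP[f fF1 xf]].
have /andP[F1D /eqP cF1] : (F1 \in Delta) && (#|F1| == d) by rewrite -facetsE.
have /andP[F2D /eqP cF2] : (F2 \in Delta) && (#|F2| == d) by rewrite -facetsE.
have cf : (#|F1 :\ f|).+1 = d by rewrite -cF1 [in RHS](cardsD1 f) fF1.
case: mat => _ _ /(_ (F1 :\ f) F2 (face_subset F1D (subD1set _ _)) F2D).
rewrite cF2 -cf ltnSn => /(_ isT) [g]; rewrite inE => /andP[gF1 gF2] gD.
have gF : g |: F1 :\ f \in facets Delta by rewrite facetsE gD cardsU1 gF1 add1n cf eqxx.
have xg : x != pi g by apply: contraNneq xF2 => ->; exact: imset_f.
have imE : pi @: (F1 :\ f) = (pi @: F1) :\ x.
  apply/setP => y; rewrite !inE; apply/imsetP/andP => [[u]|[yx /imsetP[u uF1 yu]]].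
    rewrite !inE => /andP[uf uF1] ->; rewrite imset_f // xf; split=> //.
    by apply: contraNneq uf => /(face_pi_inj F1D uF1 fF1) ->.
  by exists u => //; rewrite !inE uF1 andbT; apply: contraNneq yx => uf; rewrite yu xf uf.
exists (pi g); last by rewrite -imE -imsetU1 imset_f.
(* If the class of [g] already met [F1], the image of the facet [g |: F1 :\ f] would have only
   [d - 1] elements. *)
rewrite inE (imset_f pi gF2) andbT; apply/negP => /imsetP[u uF1 gu].
move: (cardB _ gF); rewrite imsetU1 cardsU1 imE !inE eq_sym xg /= gu imset_f //=.
rewrite add0n => cE; have := cardsD1 x (pi @: F1); rewrite cE cardB //.
by rewrite xf imset_f //; lia.
Qed.

Lemma class_bases_free (s : seq T) : (forall x, exists v, pi v = x) ->
  uniformly_free 2 s class_bases.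
Proof.
move=> surj X _ cX.
suff [F FD sX] : exists2 F, F \in Delta & X \subset pi @: F.
  have [G GF sG] := exists_facet FD; exists (pi @: G); first exact: imset_f.
  by apply: subset_trans sX _; exact: imsetS.
case: (leqP #|X| 0) => [|X0].
  rewrite leqn0 cards_eq0 => /eqP->; exists set0; last exact: sub0set.
  by case: mat => -[].
case: (leqP #|X| 1) => [X1|X1].
  have /cards1P[x ->] : #|X| == 1%N by rewrite eqn_leq X1.
  have [v <-] := surj x; exists [set v]; first by case: mat.
  by rewrite imset_set1.
have /cards2P[x [y [xy ->]]] : #|X| == 2 by rewrite eqn_leq cX.
have [[u ux] [v vy]] := (surj x, surj y).
exists [set u; v].
  by rewrite pi_edge ?ux ?vy //; apply: contraNneq xy => uv; rewrite -ux -vy uv.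
by rewrite imsetU !imset_set1 ux vy.
Qed.

End Classes.
End MatroidFacets.

Lemma partition_index n p (a : 'I_p -> nat) (A : 'I_p -> {set 'I_n}) :
  partition_of_shape a A ->
  exists pi : 'I_n -> 'I_p, forall v i, (v \in A i) = (pi v == i).
Proof.
case=> _ dis cov.
have /fin_all_exists[pi piA] v : exists i, v \in A i.
  have : v \in \bigcup_i A i by rewrite cov inE.
  by case/bigcupP => i _; exists i.
exists pi => v i; apply/idP/eqP => [vi|<- //]; apply/eqP/negPn/negP => /dis.
by move/disjointFr => /(_ v (piA v)); rewrite vi.
Qed.

Lemma card_partition_index n p (a : 'I_p -> nat) (A : 'I_p -> {set 'I_n}) pi :
  partition_of_shape a A -> (forall v i, (v \in A i) = (pi v == i)) ->
  forall i, #|[set v | pi v == i]| = a i.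
Proof. by case=> cA _ _ piA i; rewrite -cA; apply: eq_card => v; rewrite inE piA. Qed.

Lemma card_ord_lt p t : (t <= p)%N -> #|[set i : 'I_p | (i < t)%N]| = t.
Proof.
move=> tp; have winj : injective (widen_ord tp).
  by move=> x y /(congr1 val) /= /val_inj.
rewrite -[RHS]card_ord -(card_imset _ winj).
apply: eq_card => i; rewrite inE; apply/idP/imsetP => [it|[j _ ->]].
  by exists (Ordinal it) => //; apply: val_inj.
exact: ltn_ord j.
Qed.

(** * The minimal matroid *)

Section MinimalMatroid.

Variables (n p d : nat) (A : 'I_p -> {set 'I_n}) (pi : 'I_n -> 'I_p).
Hypotheses (d2 : (2 <= d)%N) (dp : (d <= p)%N).
Hypothesis piA : forall v i, (v \in A i) = (pi v == i).
Hypothesis pi_surj : forall i, exists v, pi v = i.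

Let t := (d - 2)%N.

Lemma section_imsetK (v : {ffun 'I_p -> 'I_n}) (X : {set 'I_p}) :
  (forall i, v i \in A i) -> pi @: (v @: X) = X.
Proof.
move=> vA; rewrite -imset_comp (eq_imset (g := id)) ?imset_id // => i /=.
by apply/eqP; rewrite -piA.
Qed.

Lemma gen_card F : F \in Delta_gens t d A -> #|F| = d.
Proof.
rewrite inE => /existsP[v /existsP[I /and4P[/forallP vA /eqP cI /forallP tI /eqP ->]]].
rewrite card_imset; last first.
  move=> i j vij; have := vA i; rewrite piA vij => /eqP <-.
  by have := vA j; rewrite piA => /eqP.
rewrite cardsU card_ord_lt ?cI; last by rewrite /t; lia.
rewrite (_ : _ :&: _ = set0) ?cards0; first by rewrite /t; lia.
apply/setP => i; rewrite !inE; apply/negP => /andP[it iI].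
by have /implyP/(_ iI) := tI i; rewrite leqNgt it.
Qed.

Lemma facets_Delta_t : facets (Delta_t t d A) = Delta_gens t d A.
Proof.
apply/setP => F; rewrite inE; apply/maxsetP/idP => [[]|FG].
  rewrite inE => /existsP[G /andP[GG sF]] maxF; rewrite -(maxF G) //.
  by rewrite inE; apply/existsP; exists G; rewrite GG /=.
split=> [|G]; first by rewrite inE; apply/existsP; exists F; rewrite FG /=.
rewrite inE => /existsP[H /andP[HG sG]] sF; apply/esym/eqP; rewrite eqEcard sF.
by rewrite (gen_card FG) -(gen_card HG) subset_leq_card.
Qed.

(** On the parts, the minimal matroid is uniform of rank 2 on the late parts [s1] and free on the
    first [d - 2] parts [s2]. *)
Lemma spans_Delta_t (s1 s2 : seq 'I_p) Z :
  uniq s1 -> (forall i, (i \in s1) = (t <= i)%N) ->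
  (forall i, (i \in s2) = (i < t)%N) ->
  spans (facets (Delta_t t d A)) Z =
    (2 <= count (mem (pi @: Z)) s1)%N && all (mem (pi @: Z)) s2.
Proof.
move=> us1 s1E s2E; rewrite facets_Delta_t -size_filter.
apply/existsP/andP => [[F /andP[]]|[]].
  rewrite inE => /existsP[v /existsP[I /and4P[/forallP vA /eqP cI /forallP tI /eqP ->]]].
  move/(imsetS pi); rewrite section_imsetK // subUset => /andP[sT sI]; split.
    apply: (@leq_trans #|I|); first by rewrite cI /t; lia.
    rewrite cardE; apply: uniq_leq_size (enum_uniq _) _ => i.
    rewrite mem_enum mem_filter /= => iI; rewrite (subsetP sI) //= s1E.
    by have /implyP/(_ iI) := tI i.
  by apply/allP => i; rewrite s2E => it; apply: (subsetP sT); rewrite inE.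
move=> /size_takel c2 /allP all2.
pose I := [set i in take 2 (filter (mem (pi @: Z)) s1)].
have cI : #|I| = 2.
  by rewrite cardsE (card_uniqP _) // take_uniq // filter_uniq.
have IE i : i \in I -> (i \in pi @: Z) && (t <= i)%N.
  by rewrite inE => /mem_take; rewrite mem_filter s1E.
(* The section takes its values in [Z] wherever [Z] meets the part, and arbitrary values in the part
   elsewhere. *)
have /fin_all_exists[v vP] i : exists z, (pi z == i) && ((i \in pi @: Z) ==> (z \in Z)).
  have [/imsetP[z zZ ->]|iZ] := boolP (i \in pi @: Z); first by exists z; rewrite eqxx zZ.
  by have [z <-] := pi_surj i; exists z; rewrite eqxx.
have vE i : [ffun i => v i] i = v i by rewrite ffunE.
exists ([ffun i => v i] @: ([set i : 'I_p | (i < t)%N] :|: I)); apply/andP; split.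
  rewrite inE; apply/existsP; exists [ffun i => v i]; apply/existsP; exists I.
  rewrite eqxx cI andbT; apply/and3P; split.
  - by apply/forallP => i; rewrite vE piA; case/andP: (vP i).
  - by rewrite /t; lia.
  - by apply/forallP => i; apply/implyP => /IE/andP[].
apply/subsetP => _ /imsetP[i iI ->]; rewrite vE; have /andP[_ /implyP] := vP i.
apply; case/setUP: iI => [|/IE/andP[] //].
by rewrite inE -s2E => /all2.
Qed.

End MinimalMatroid.

(** * Comparison of the h-vectors *)

Lemma weighted_sum_h_vector n (k : fieldType) (Delta : {set {set 'I_n}}) d
    (T : finType) (pi : 'I_n -> T) (s : seq T) (S : pred {set T}) h :
  facets Delta != set0 -> (forall F, F \in facets Delta -> #|F| = d) ->
  uniq s -> (forall i, i \in s) ->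
  (forall Z, spans (facets Delta) Z = S (pi @: Z)) ->
  weighted_sum (fun i => #|[set v | pi v == i]|) s S = (1 - 'X) ^+ d * h ->
  forall j, h_vector k Delta j = h`_j.
Proof.
move=> F0 Fd us sT SE hE.
have dn : (d <= n)%N.
  by have /set0Pn[F FF] := F0; rewrite -(Fd F FF) -[X in (_ <= X)%N]card_ord max_card.
apply: (h_vectorE dn); first exact: krull_dim_cover.
rewrite -hE -weighted_sum_fibers //.
have -> : [set v | pi v \in s] = setT by apply/setP => v; rewrite !inE sT.
by apply: eq_big => [Z|Z _]; rewrite ?subsetT ?SE.
Qed.

Theorem theorem4p3 (k : fieldType) (n d p : nat) (a : 'I_p -> nat)
    (Dmin Delta : {set {set 'I_n}}) :
  (2 <= d)%N -> (d <= p)%N -> (forall i, 0 < a i)%N -> (\sum_(i < p) a i)%N = n ->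
  is_Delta_min d a Dmin -> matroid_class d a Delta ->
  forall j : nat, (h_vector k Dmin j <= h_vector k Delta j)%R.
Proof.
move=> d2 dp a0 _ [sigma [A [a_mono Apart ->]]] [mat rankD [A' [A'part edges]]] j.
have [pi piA] := partition_index Apart.
have [pi' piA'] := partition_index A'part.
pose b i := a (sigma i).
have fib : forall i, #|[set v | pi v == i]| = b i.
  exact: card_partition_index Apart piA.
(* The parts of [Delta] are relabelled by the inverse of [sigma], so that both complexes have the
   same part sizes [b]. *)
have fib' i : #|[set v | (sigma^-1)%g (pi' v) == i]| = b i.
  rewrite /b -(card_partition_index A'part piA'); apply: eq_card => v; rewrite !inE.
  by rewrite (canF_eq (permKV sigma)).
have surj (f : 'I_n -> 'I_p) : (forall i, #|[set v | f v == i]| = b i) ->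
    forall i, exists v, f v = i.
  move=> fibf i; have : (0 < #|[set v | f v == i]|)%N by rewrite fibf a0.
  by rewrite card_gt0 => /set0Pn[v]; rewrite inE => /eqP; exists v.
(* Since [b] is nondecreasing, reversal lists the parts by nonincreasing size, with the [d - 2]
   smallest ones in [s2]. *)
pose s1 := rev [seq i : 'I_p <- enum 'I_p | (d - 2 <= i)%N].
pose s2 := rev [seq i : 'I_p <- enum 'I_p | (i < d - 2)%N].
have s1E i : (i \in s1) = (d - 2 <= i)%N.
  by rewrite mem_rev mem_filter mem_enum andbT.
have s2E i : (i \in s2) = (i < d - 2)%N.
  by rewrite mem_rev mem_filter mem_enum andbT.
have us1 : uniq s1 by rewrite rev_uniq filter_uniq ?enum_uniq.
have us : uniq (s1 ++ s2).
  rewrite cat_uniq us1 rev_uniq filter_uniq ?enum_uniq // andbT /=.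
  by apply/hasPn => i; rewrite s2E /= s1E -ltnNge.
have sT i : i \in s1 ++ s2 by rewrite mem_cat s1E s2E leqNgt orNb.
have us2 : uniq s2 by move: us; rewrite cat_uniq => /and3P[].
have size2 : size s2 = (d - 2)%N.
  rewrite -(card_uniqP us2) -(card_ord_lt (p := p) (t := d - 2)); last by lia.
  by apply: eq_card => i; rewrite inE s2E.
have dE : d = (2 + size s2)%N by rewrite size2; lia.
have b_trans : transitive (fun x y => b x <= b y)%N by move=> y x z; apply: leq_trans.
have sorted_rev (P : pred 'I_p) :
    pairwise (fun x y => b y <= b x)%N (rev [seq i <- enum 'I_p | P i]).
  rewrite -sorted_pairwise; last by move=> y x z yx zy; apply: leq_trans zy yx.
  rewrite rev_sorted; apply: sorted_filter => //.
  apply: (sub_sorted (e := fun x y : 'I_p => (x <= y)%N)); first exact: a_mono.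
  by have := iota_sorted 0 p; rewrite -val_enum_ord sorted_map.
have sorted_s : pairwise (fun x y => b y <= b x)%N (s1 ++ s2).
  rewrite pairwise_cat !sorted_rev !andbT; apply/allrelP => x y.
  by rewrite s1E s2E => tx yt; apply: a_mono; apply: leq_trans (ltnW yt) tx.
have minE := weighted_sum_min b 2 us; rewrite -dE in minE.
pose q := fun v => (sigma^-1)%g (pi' v).
have q_edge u v : u != v -> ([set u; v] \in Delta) = (q u != q v).
  move=> uv; have := edges u v; rewrite /skeleton_edge uv /= => ->.
  rewrite (inj_eq perm_inj); congr (~~ _); apply/existsP/eqP => [[i]|E].
    by rewrite !piA' => /andP[/eqP-> /eqP->].
  by exists (pi' u); rewrite !piA' E eqxx.
have [h hE hn] := weighted_sum_bound us sorted_s dE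
  (class_bases_system mat rankD q_edge sT)
  (class_bases_free (s := s1 ++ s2) mat q_edge (surj _ fib')).
have facets_min := facets_Delta_t d2 dp piA.
have genC : forall F, F \in facets (Delta_t (d - 2) d A) -> #|F| = d.
  by rewrite facets_min; exact: gen_card.
have facC F : F \in facets Delta -> #|F| = d.
  by rewrite (facetsE mat rankD) => /andP[_ /eqP].
have fac0 : facets Delta != set0.
  have D0 : set0 \in Delta by case: mat => -[].
  by have [F FF _] := exists_facet D0; apply/set0Pn; exists F.
(* The full vertex set is spanning, since [d <= p] leaves at least two parts in [s1]. *)
have min0 : facets (Delta_t (d - 2) d A) != set0.
  have : spans (facets (Delta_t (d - 2) d A)) setT.
    rewrite (spans_Delta_t d2 dp piA (surj _ fib) _ us1 s1E s2E).
    have piT : pi @: setT = setT.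
      apply/setP => i; rewrite inE; apply/imsetP.
      by have [v <-] := surj _ fib i; exists v; rewrite ?inE.
    rewrite piT (eq_count (a2 := xpredT)); last by move=> i; rewrite /= inE.
    rewrite count_predT; apply/andP; split; last by apply/allP => i; rewrite /= inE.
    have : size (s1 ++ s2) = p.
      by rewrite -(card_uniqP us) -[RHS]card_ord; apply: eq_card => i; rewrite sT.
    by rewrite size_cat size2; move: (size s1) => m; lia.
  by case/existsP => F /andP[FF _]; apply/set0Pn; exists F.
have ws_eq (f : 'I_n -> 'I_p) S : (forall i, #|[set v | f v == i]| = b i) ->
    weighted_sum (fun i => #|[set v | f v == i]|) (s1 ++ s2) S
      = weighted_sum b (s1 ++ s2) S.
  move=> fibf; elim: (s1 ++ s2) S => //= e s IH S; rewrite fibf.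
  by rewrite !IH.
rewrite (weighted_sum_h_vector k min0 genC us sT
  (fun Z => spans_Delta_t d2 dp piA (surj _ fib) Z us1 s1E s2E)
  (etrans (ws_eq _ _ fib) minE)).
rewrite (weighted_sum_h_vector k fac0 facC us sT
  (spans_class_bases mat rankD q_edge) (etrans (ws_eq _ _ fib') hE)).
exact: nneg_coef.
Qed.
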